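(* Let $n\ge5$ and let $P^n_\omega$ be a non-trivially weighted edge-weighted path with vertices $x_1,\dots,x_n$, edges $e_i=\{x_i,x_{i+1}\}$ and weights $\omega_i=\omega(e_i)$, whose edge ideal $I=I(P^n_\omega)\subseteq S=\mathbb{K}[x_1,\dots,x_n]$ is integrally closed. Let $\omega=\max\{\omega_i\mid i\in[n-1]\}$. Then for all $t\ge1$, $$\operatorname{reg}(S/I^t)\le\operatorname{reg}(S/I)+2(t-1)\omega.$$
   Context: $\mathbb{K}$ is a field. For a simple graph $G$ with weight function $\omega:E(G)\to\mathbb{Z}_{>0}$, $I(G_\omega)=(x_i^{\omega(e)}x_j^{\omega(e)}\mid e=\{x_i,x_j\}\in E(G))$. An edge has non-trivial weight if its weight is $\ge2$; the path is non-trivially weighted if some edge does. An ideal is integrally closed if it equals its integral closure. *)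

(* Defs.v *)
From HB Require Import structures.
From mathcomp Require Import all_boot all_order all_algebra.
From mathcomp Require Import mpoly.
From Stdlib Require Import ClassicalEpsilon.

Set Implicit Arguments.
Unset Strict Implicit.
Unset Printing Implicit Defensive.

Import GRing.Theory.
Local Open Scope ring_scope.

Definition pbool (P : Prop) : bool :=
  if excluded_middle_informative P then true else false.

Section Ideals.
Variables (K : fieldType) (n : nat).

Definition in_ideal (G : seq {mpoly K[n]}) (f : {mpoly K[n]}) : Prop :=
  exists c : seq {mpoly K[n]},
    size c = size G /\ f = \sum_(i < size G) c`_i * G`_i.

Definition ideal_pow_gens (G : seq {mpoly K[n]}) (t : nat) : seq {mpoly K[n]} :=
  iter t (fun H => [seq g * h | g <- G, h <- H]) [:: 1].

Definition integral_over_ideal (G : seq {mpoly K[n]}) (f : {mpoly K[n]}) : Prop :=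
  exists k : nat, (0 < k)%N /\
  exists a : nat -> {mpoly K[n]},
    (forall i, (1 <= i <= k)%N -> in_ideal (ideal_pow_gens G i) (a i)) /\
    f ^+ k + \sum_(1 <= i < k.+1) a i * f ^+ (k - i) = 0.

Definition integrally_closed (G : seq {mpoly K[n]}) : Prop :=
  forall f, integral_over_ideal G f -> in_ideal G f.

(* ---------- Koszul homology of S/I (computes Tor_i^S(S/I, K)_j) ---------- *)

(* x^m is a standard monomial: it does not lie in I = (G); the standard
   monomials form a K-basis of S/I when I is a monomial ideal. *)
Definition std_mono (G : seq {mpoly K[n]}) (m : 'X_{1..n}) : bool :=
  ~~ pbool (in_ideal G 'X_[m]).

(* Basis of the degree-j part of K_i = S/I (x) wedge^i K^n :
   elements x^m e_F with |F| = i, deg m + i = j, x^m standard. *)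
Definition kbasis (G : seq {mpoly K[n]}) (i j : nat)
  : seq ('X_{1..n < j.+1} * {set 'I_n}) :=
  filter (fun p : 'X_{1..n < j.+1} * {set 'I_n} =>
            [&& (mdeg (bmnm p.1) + #|p.2| == j)%N, #|p.2| == i
              & std_mono G (bmnm p.1)])
         (enum [set: ('X_{1..n < j.+1} * {set 'I_n})%type]).

(* Koszul differential d_i : K_i -> K_(i-1) in internal degree j (i >= 1),
   d(x^m e_F) = sum_(k in F) (-1)^#{l in F | l < k} x_k x^m e_(F \ k),
   as a matrix acting on row vectors. *)
Definition kdiff (G : seq {mpoly K[n]}) (i j : nat)
  : 'M[K]_(size (kbasis G i j), size (kbasis G i.-1 j)) :=
  \matrix_(r, c)
    (let p := nth (bm0, set0) (kbasis G i j) r in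
     let q := nth (bm0, set0) (kbasis G i.-1 j) c in
     \sum_(k in p.2)
        (if (q.2 == p.2 :\ k) && (bmnm q.1 == (bmnm p.1 + mnm1 k)%MM)
         then (-1) ^+ #|[set l in p.2 | (l < k)%N]| else 0)).

Definition kdiff_rank (G : seq {mpoly K[n]}) (i j : nat) : nat :=
  if i is 0 then 0%N else \rank (kdiff G i j).

(* H_i(x; S/I)_j <> 0, i.e. beta_{i,j}(S/I) <> 0 *)
Definition betti_nz (G : seq {mpoly K[n]}) (i j : nat) : bool :=
  (kdiff_rank G i.+1 j < size (kbasis G i j) - kdiff_rank G i j)%N.

Definition reg_le (G : seq {mpoly K[n]}) (r : nat) : Prop :=
  forall i j, betti_nz G i j -> (j <= i + r)%N.

Definition is_reg (G : seq {mpoly K[n]}) (r : nat) : Prop :=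
  reg_le G r /\ forall r', reg_le G r' -> (r <= r')%N.

(* Edge ideal of the weighted path x_1 - ... - x_n (0-based: edge i joins
   variables i and i+1, weight w i), generators (x_i x_(i+1))^(w i). *)
Definition path_edge_gens (w : nat -> nat) : seq {mpoly K[n]} :=
  [seq 'X_[[multinom (if (k == i :> nat) || (k == i.+1 :> nat) then w i else 0%N)
                       | k < n]]
   | i <- iota 0 n.-1].

End Ideals.

(* Main.v *)
Require Import Defs.
From HB Require Import structures.
From mathcomp Require Import all_boot all_order all_algebra.
From mathcomp Require Import mpoly.
From Stdlib Require Import ClassicalEpsilon.
From mathcomp Require Import zify ring.

(** If the path is integrally closed, two edges of weight at least 2 are always
    at distance exactly two along the path, so there are at most two of them:
    [x^2] in [I^2] forces [x] in [I], and otherwise the "square root" of the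
    product of the two generators violates this.

    Write [reg M] for [reg (S/M)].  For a monomial [f],
    [reg M <= max (reg (M:f) + deg f, reg (M,f))], and
    [reg (M:f) + deg f <= max (reg M, reg (M,f) + 1)].  If [xy] is an unweighted
    leaf edge, then [I^(t+1) : xy = I^t], and killing or dividing out [y] then
    leaves powers of ideals of shorter paths.  Unweighted arms are thus stripped
    from both ends.  What remains is a single edge, where [I] is principal, or
    [(xy)^a, yv, (vz)^b], where the bound follows by inspecting which
    multidegrees can carry Koszul homology.

    The lower bound on [reg I] that is needed to close the induction comes from
    restricting to the first edge [f] and the part of the path at distance at
    least two from it: there [f] is a nonzerodivisor and raises the regularity by
    [deg f - 1]. *)

Set Implicit Arguments.
Unset Strict Implicit.
Unset Printing Implicit Defensive.

Import GRing.Theory.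

(** * Strands of the Koszul complex *)

Section KoszulStrands.
Local Open Scope ring_scope.
Variables (K : fieldType) (n : nat).
Implicit Types (i : nat) (u v : {set 'I_n} -> K) (F G : {set 'I_n}) (V P : pred {set 'I_n}).

Definition koszul_sign (k : 'I_n) G : K := (-1) ^+ #|[set l in G | (l < k)%N]|.

(** Within one multidegree the face determines the monomial, so a chain is just its coefficient
    function [u], and the differential reduces to signs. *)
Definition koszul_bd u G : K :=
  \sum_(k | k \notin G) koszul_sign k G * u (k |: G).

Definition supported V (i : nat) u := forall F, u F != 0 -> V F && (#|F| == i).

(* [V] indexes the basis of one multigraded strand of the Koszul complex; the
   strand is the span of [V] with the differential truncated to [V]. *)
Definition acyclic V i := forall u, supported V i u ->
  (forall G, V G -> koszul_bd u G = 0) ->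
  exists2 v, supported V i.+1 v & forall G, V G -> koszul_bd v G = u G.

(** The condition under which truncating the differential to [V] still squares to zero. *)
Definition convex V := forall G k l, V G -> V (l |: (k |: G)) -> V (k |: G).

Lemma koszul_sign_sq k G : koszul_sign k G * koszul_sign k G = 1.
Proof. by rewrite /koszul_sign -expr2 sqrr_sign. Qed.

Lemma koszul_signU k l G : k \notin G ->
  koszul_sign l (k |: G) = (-1) ^+ (k < l)%N * koszul_sign l G.
Proof.
move=> kG; rewrite /koszul_sign -exprD; congr (_ ^+ _).
case: ltnP => kl.
  rewrite (_ : [set _ in _ | _] = k |: [set l0 in G | (l0 < l)%N]).
    by rewrite cardsU1 inE (negbTE kG).
  by apply/setP=> a; rewrite !inE; case: eqVneq => // ->; rewrite kl.
rewrite add0n; apply: eq_card => a; rewrite !inE.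
by case: eqVneq => //= ->; rewrite (negbTE kG) ltnNge kl.
Qed.

Lemma koszul_bdD u v G :
  koszul_bd (fun F => u F + v F) G = koszul_bd u G + koszul_bd v G.
Proof. by rewrite -big_split; apply: eq_bigr => k _; rewrite mulrDr. Qed.

Lemma koszul_bdB u v G :
  koszul_bd (fun F => u F - v F) G = koszul_bd u G - koszul_bd v G.
Proof. by rewrite -sumrB; apply: eq_bigr => k _; rewrite mulrBr. Qed.

Lemma eq_koszul_bd u v G :
  (forall k, k \notin G -> u (k |: G) = v (k |: G)) ->
  koszul_bd u G = koszul_bd v G.
Proof. by move=> uv; apply: eq_bigr => k kG; rewrite uv. Qed.

Lemma koszul_bd_eq0 u G :
  (forall k, k \notin G -> u (k |: G) = 0) -> koszul_bd u G = 0.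
Proof. by move=> u0; apply: big1 => k kG; rewrite u0 ?mulr0. Qed.

Lemma koszul_bd_neq0 u G : koszul_bd u G != 0 ->
  exists2 k, k \notin G & u (k |: G) != 0.
Proof.
move=> nz; have [k /andP[kG ku]|no] := pickP [pred k | (k \notin G) && (u (k |: G) != 0)].
  by exists k.
case/eqP: nz; apply: koszul_bd_eq0 => k kG.
by apply/eqP; move: (no k); rewrite /= kG /= => /negbFE.
Qed.

(** The double sum runs over ordered pairs of distinct indices, and swapping the two indices changes
    the sign of each term. *)
Lemma koszul_bd_bd u G : koszul_bd (koszul_bd u) G = 0.
Proof.
pose T k l := koszul_sign k G * (koszul_sign l (k |: G) * u (l |: (k |: G))).
have -> : koszul_bd (koszul_bd u) G =
    \sum_k \sum_(l | [&& k \notin G, l \notin G & k != l]) T k l.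
  rewrite /koszul_bd big_mkcond; apply: eq_bigr => k _.
  case: ifP => kG /=; last by rewrite big_pred0.
  rewrite mulr_sumr; apply: eq_bigl => l.
  by rewrite !inE negb_or andbC eq_sym.
have TN k l : k \notin G -> l \notin G -> k != l -> T l k = - T k l.
  move=> kG lG kl; rewrite /T !koszul_signU // setUCA.
  have : (-1) ^+ (k < l)%N = - (-1) ^+ (l < k)%N :> K.
    case: (ltngtP k l) => [//|//|/val_inj e]; last by rewrite e eqxx in kl.
    by rewrite expr0 expr1 opprK.
  by move=> ->; ring.
rewrite pair_big_dep /=.
rewrite (bigID (fun p : 'I_n * 'I_n => (p.1 < p.2)%N)) /=.
rewrite [X in _ + X](reindex_inj (h := fun p : 'I_n * 'I_n => (p.2, p.1))) /=;
  last by move=> [a b] [c d] [-> ->].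
rewrite [X in _ + X](_ : _ = - \sum_(p : 'I_n * 'I_n | [&& p.1 \notin G, p.2 \notin G
    & p.1 != p.2] && (p.1 < p.2)%N) T p.1 p.2); first by rewrite subrr.
rewrite -sumrN; apply: eq_big => [[k l]|[k l]] /=.
  rewrite -leqNgt leq_eqVlt (eq_sym l k) andbCA.
  by case: (eqVneq k l) => [->|/negbTE kl]; rewrite ?andbF // val_eqE kl.
by case/andP=> /and3P[lG kG lk] _; rewrite TN // eq_sym.
Qed.

(** By convexity, the boundary of [u] already vanishes at each face [k |: G] that the truncation
    discards. *)
Lemma koszul_bd_trunc V u G : convex V -> (forall F, u F != 0 -> V F) -> V G ->
  koszul_bd (fun F => if V F then koszul_bd u F else 0) G = 0.
Proof.
move=> cV uV VG; rewrite -[RHS](koszul_bd_bd u G); apply: eq_koszul_bd => k kG.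
case: ifPn => // nV; apply/esym/koszul_bd_eq0 => l lk.
by apply/eqP; apply: contraNT nV => /uV; apply: cV.
Qed.

Lemma supported_trunc V i v : supported V i.+1 v ->
  forall F, V F -> koszul_bd v F != 0 -> #|F| = i.
Proof.
move=> sv F VF /koszul_bd_neq0[k kF /sv /andP[_]].
by rewrite cardsU1 kF => /eqP[].
Qed.

Lemma acyclic_empty V i : (forall F, V F -> #|F| != i) -> acyclic V i.
Proof.
move=> nV u su _; exists (fun=> 0) => [F|G VG]; first by rewrite eqxx.
rewrite koszul_bd_eq0 //; apply/esym/eqP; apply/negPn/negP => /su/andP[V2 /eqP e].
by move: (nV _ V2); rewrite e eqxx.
Qed.

Lemma eq_acyclic V V' i : V =1 V' -> acyclic V i -> acyclic V' i.
Proof.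
move=> e aV u su cu; have [|G|v sv bv] := aV u.
- by move=> F /su; rewrite e.
- by rewrite e; apply: cu.
exists v => [F /sv|G]; first by rewrite e.
by rewrite -e; apply: bv.
Qed.

(** Wedging with [e_x] is a contracting homotopy. *)
Lemma acyclic_cone V x i :
  (forall F, x \notin F -> V (x |: F) = V F) -> acyclic V i.
Proof.
move=> Vx u su cu.
exists (fun F => if x \in F then koszul_sign x (F :\ x) * u (F :\ x) else 0).
  move=> F; case: ifP => [xF|]; last by rewrite eqxx.
  rewrite mulf_eq0 negb_or => /andP[_ /su].
  have := Vx (F :\ x); rewrite setD1K // !inE eqxx => -> //.
  by rewrite [#|F|](cardsD1 x) xF => /andP[-> /eqP ->] /=.
move=> G VG; have [xG|xG] := boolP (x \in G); last first.
  rewrite /koszul_bd (bigD1 x) //= big1 => [|k /andP[kG kx]].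
    by rewrite addr0 !inE eqxx /= setU1K // mulrA koszul_sign_sq mul1r.
  by rewrite !inE eq_sym (negbTE kx) (negbTE xG) mulr0.
pose G0 := G :\ x; have xG0 : x \notin G0 by rewrite !inE eqxx.
have GE : G = x |: G0 by rewrite setD1K.
have VG0 : V G0 by rewrite -Vx -?GE.
(* The cycle condition at [G0] expresses [u G] through the values [u (k |: G0)], which are the terms
   of the boundary sought. *)
have := cu _ VG0; rewrite /koszul_bd (bigD1 x) //= -GE => /eqP.
rewrite addr_eq0 => /eqP uG.
have -> : u G = koszul_sign x G0 * (koszul_sign x G0 * u G).
  by rewrite mulrA koszul_sign_sq mul1r.
rewrite uG -sumrN mulr_sumr; apply: eq_big => [k|k kG].
  by rewrite GE !inE negb_or andbC.
have kx : k != x by apply: contraNneq kG => ->.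
have kG0 : k \notin G0 by rewrite !inE (negbTE kG) andbF.
rewrite !inE xG orbT.
have -> : (k |: G) :\ x = k |: G0.
  by rewrite GE setUCA setU1K // in_setU1 negb_or eq_sym kx.
rewrite [in koszul_sign k G]GE !koszul_signU //.
have -> : (-1) ^+ (x < k)%N = - (-1) ^+ (k < x)%N :> K.
  case: (ltngtP k x) => [//|//|/val_inj e]; last by rewrite e eqxx in kx.
  by rewrite expr0 expr1 opprK.
have := sqrr_sign K (k < x)%N; rewrite expr2 => e.
transitivity (- ((-1) ^+ (k < x)%N * (-1) ^+ (k < x)%N) *
  (koszul_sign k G0 * koszul_sign x G0 * u (k |: G0))); first by ring.
by rewrite e; ring.
Qed.

(* Strands of the short exact sequence of Koszul complexes attached to
   [0 -> S/(M:f) -> S/M -> S/(M,f) -> 0]: [P] cuts out the subcomplex. *)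
Section LongExactSequence.
Variables (V P : pred {set 'I_n}).
Hypothesis cV : convex V.
Hypothesis subP : forall k G, V G -> V (k |: G) -> P (k |: G) -> P G.
Let V' := [pred F | V F && P F].
Let V'' := [pred F | V F && ~~ P F].

Let off u F := if P F then 0 else u F.

Let off_supp i u : supported V i u -> supported V'' i (off u).
Proof.
move=> su F; rewrite /off /=; case: ifP => [|_ /su /andP[-> ->]] //.
by rewrite eqxx.
Qed.

Let bd_off i u G : supported V i u -> V'' G -> koszul_bd (off u) G = koszul_bd u G.
Proof.
move=> su /andP[VG PG]; apply: eq_koszul_bd => k kG; rewrite /off.
case: ifP => // Pk; apply/esym/eqP; apply: contraNT PG => /su /andP[Vk _].
exact: subP Vk Pk.
Qed.

Let bd_sub i u G : supported V' i u -> V'' G -> koszul_bd u G = 0.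
Proof.
move=> su /andP[VG PG]; apply: koszul_bd_eq0 => k kG.
by apply/eqP; apply: contraNT PG => /su /andP[/andP[Vk Pk] _]; apply: subP Vk Pk.
Qed.

Let supp_sub i u : supported V' i u -> supported V i u.
Proof. by move=> su F /su /andP[/andP[-> _] ->]. Qed.

Let supp_quo i u : supported V'' i u -> supported V i u.
Proof. by move=> su F /su /andP[/andP[-> _] ->]. Qed.

Let supp_V i u : supported V i u -> forall F, u F != 0 -> V F.
Proof. by move=> su F /su/andP[]. Qed.

(** Bound the image of [u] in the quotient by [v'']; then [u] minus the boundary of [v''] is a cycle
    of the subcomplex. *)
Lemma acyclic_mid i : acyclic V' i -> acyclic V'' i -> acyclic V i.
Proof.
move=> a' a'' u su cu.
have [|G V2|v'' s'' b''] := a'' (off u); first exact: off_supp.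
  by rewrite (bd_off su) // cu //; case/andP: V2.
have sv'' := supp_quo s''.
have [F|G /andP[VG _]|v' s' b'] :=
  a' (fun F => u F - (if V F then koszul_bd v'' F else 0)).
- case VF: (V F); last first.
    by rewrite subr0 => /su; rewrite VF.
  case PF: (P F); last first.
    by rewrite b'' /= ?VF ?PF // /off PF subrr eqxx.
  rewrite /= VF PF /=; case: (eqVneq (u F) 0) => [->|/su /andP[] //].
  by rewrite sub0r oppr_eq0 => /(supported_trunc sv'' VF) ->.
- by rewrite koszul_bdB cu // koszul_bd_trunc ?subrr //; apply: supp_V sv''.
exists (fun F => v' F + v'' F).
  move=> F; case: (eqVneq (v' F) 0) => [->|/(supp_sub s') //].
  by rewrite add0r => /sv''.
move=> G VG; rewrite koszul_bdD; case PG: (P G).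
  by rewrite b' /= ?VG ?PG // subrK.
have V2 : V'' G by rewrite /= VG PG.
by rewrite (bd_sub s') // b'' // add0r /off PG.
Qed.

(** If [v] bounds [u] in [V], its part outside [P] is a cycle of the quotient; subtracting the
    boundary of a chain [w] that kills it moves [v] into the subcomplex. *)
Lemma acyclic_sub i : acyclic V i -> acyclic V'' i.+1 -> acyclic V' i.
Proof.
move=> aV a'' u su cu.
have [|G VG|v sv bv] := aV u; first exact: supp_sub.
  case PG: (P G); first by rewrite cu //= VG PG.
  by rewrite (bd_sub su) //= VG PG.
have [|G /andP[VG PG]|w sw bw] := a'' (off v); first exact: off_supp.
  rewrite (bd_off sv) /= ?VG ?PG // bv //.
  by apply/eqP; apply: contraNT PG => /su /andP[/andP[]].
have sw' := supp_quo sw.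
exists (fun F => v F - (if V F then koszul_bd w F else 0)).
  move=> F; case VF: (V F); last by rewrite subr0 => /sv; rewrite VF.
  case PF: (P F); last by rewrite bw /= ?VF ?PF // /off PF subrr eqxx.
  rewrite /= VF PF /=; case: (eqVneq (v F) 0) => [->|/sv /andP[] //].
  by rewrite sub0r oppr_eq0 => /(supported_trunc sw' VF) ->.
move=> G /andP[VG PG]; rewrite koszul_bdB bv // koszul_bd_trunc ?subr0 //.
exact: supp_V sw'.
Qed.

(** The boundary of a lifted quotient cycle is a cycle of the subcomplex. Bounding it by [v'] makes
    [u - v'] a cycle of [V]. *)
Lemma acyclic_quo i : acyclic V' i -> acyclic V i.+1 -> acyclic V'' i.+1.
Proof.
move=> a' aV u su cu; have suV := supp_quo su.
have [F|G /andP[VG PG]|v' s' b'] :=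
    a' (fun F => if V F then koszul_bd u F else 0).
- case VF: (V F); last by rewrite eqxx.
  case PF: (P F); last by rewrite cu /= ?VF ?PF // eqxx.
  by rewrite /= VF PF => /(supported_trunc suV VF) ->; rewrite eqxx.
- by rewrite koszul_bd_trunc //; apply: supp_V suV.
have [F|G VG|w sw bw] := aV (fun F => u F - v' F).
- case: (eqVneq (u F) 0) => [->|/suV //].
  by rewrite sub0r oppr_eq0 => /(supp_sub s').
- rewrite koszul_bdB; case PG: (P G).
    by rewrite b' /= ?VG ?PG // subrr.
  by rewrite cu ?(bd_sub s') ?subrr //= VG PG.
exists (off w); first exact: off_supp.
move=> G V2; rewrite (bd_off sw) // bw; last by case/andP: V2.
case/andP: V2 => VG PG.
suff -> : v' G = 0 by rewrite subr0.
by apply/eqP; apply: contraNT PG => /s' /andP[/andP[]].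
Qed.

End LongExactSequence.
End KoszulStrands.

(** * Regularity of monomial ideals *)

Section MonomialRegularity.
Variables (K : fieldType) (n : nat).
Implicit Types (M : pred 'X_{1..n}) (f m al be : 'X_{1..n}) (F G : {set 'I_n}).
Implicit Types (d r i : nat) (x : 'I_n).

Definition set_mnm F : 'X_{1..n} := [multinom (j \in F : nat) | j < n].

Lemma set_mnmE F j : set_mnm F j = (j \in F).
Proof. exact: mnmE. Qed.

Lemma mdeg_set_mnm F : mdeg (set_mnm F) = #|F|.
Proof.
rewrite mdegE -sum1_card [RHS]big_mkcond; apply: eq_bigr => j _.
by rewrite set_mnmE; case: (_ \in _).
Qed.

(* Monomial ideals are represented by the predicate of the monomials they contain. *)
Definition up_closed M := forall m m', (m <= m')%MM -> M m -> M m'.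

Definition colon M f : pred 'X_{1..n} := fun m => M (m + f)%MM.

Definition add_gen M f : pred 'X_{1..n} := fun m => M m || (f <= m)%MM.

Definition indep M x := forall m, M (m + U_(x))%MM = M m.

(* The faces [F] for which [x^(al - F) e_F] is a basis element of the Koszul
   complex of [S/M] in multidegree [al]. *)
Definition std M al : pred {set 'I_n} :=
  fun F => (set_mnm F <= al)%MM && ~~ M (al - set_mnm F)%MM.

(* [reg (S/M) + d <= r]; keeping [d] avoids truncated subtraction. *)
Definition reg_bound M d r :=
  forall al i, i + r < mdeg al + d -> acyclic K (std M al) i.

Lemma std_leU al G k : (set_mnm (k |: G) <= al)%MM -> (set_mnm G <= al)%MM.
Proof.
move/mnm_lepP => le; apply/mnm_lepP => j; apply: leq_trans (le j).
by rewrite !set_mnmE !inE; case: (j == k); case: (j \in G).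
Qed.

Lemma sub_std_leU al G k : (al - set_mnm (k |: G) <= al - set_mnm G)%MM.
Proof.
apply/mnm_lepP => j; rewrite !mnmBE leq_sub2l //.
by rewrite !set_mnmE !inE; case: (j == k); case: (j \in G).
Qed.

Lemma convex_std M al : up_closed M -> convex (std M al).
Proof.
move=> upM G k l /andP[_ nG] /andP[le _]; rewrite /std (std_leU le).
by apply: contra nG; apply: upM; apply: sub_std_leU.
Qed.

Lemma eq_std M M' al : M =1 M' -> std M al =1 std M' al.
Proof. by move=> e F; rewrite /std e. Qed.

Lemma eq_reg_bound M M' d r : M =1 M' -> reg_bound M d r -> reg_bound M' d r.
Proof. by move=> e b al i lt; apply: eq_acyclic (b al i lt); apply: eq_std. Qed.

Lemma reg_bound_weaken M d r d' r' :
  r + d' <= r' + d -> reg_bound M d r -> reg_bound M d' r'.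
Proof. by move=> le b al i lt; apply: b; lia. Qed.

Lemma reg_bound_unit M d r : (forall m, M m) -> reg_bound M d r.
Proof. by move=> M1 al i _; apply: acyclic_empty => F; rewrite /std M1 andbF. Qed.

Lemma up_closed_add_gen M f : up_closed M -> up_closed (add_gen M f).
Proof.
move=> upM m m' le /orP[Mm|fm]; rewrite /add_gen; first by rewrite (upM _ _ le).
by rewrite (lepm_trans fm le) orbT.
Qed.

Lemma up_closed_colon M f : up_closed M -> up_closed (colon M f).
Proof.
move=> upM m m' /mnm_lepP le; apply: upM; apply/mnm_lepP => j.
by rewrite !mnmDE leq_add2r.
Qed.

Section ColonSequence.
Variables (M : pred 'X_{1..n}) (f : 'X_{1..n}).
Hypothesis upM : up_closed M.

(** Selects the basis elements whose monomial is divisible by [f], that is, the image of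
    multiplication by [f] from [S/(M:f)]. *)
Let P al F := (f <= al - set_mnm F)%MM.

Let subP al k G : std M al G -> std M al (k |: G) -> P al (k |: G) -> P al G.
Proof. by move=> _ _ h; apply: lepm_trans h (sub_std_leU _ _ _). Qed.

Let std_colon be :
  [pred F | std M (be + f)%MM F && P (be + f)%MM F] =1 std (colon M f) be.
Proof.
move=> F /=; rewrite /std /P /colon.
have [le|nle] := boolP (set_mnm F <= be)%MM.
  have E : (be + f - set_mnm F = be - set_mnm F + f)%MM.
    apply/mnmP => j; rewrite !mnmE; move/mnm_lepP/(_ j): le.
    by rewrite set_mnmE; lia.
  by rewrite E lem_addl andbT (lepm_trans le (lem_addr _ _)).
apply/negbTE; apply: contra nle => /andP[/andP[/mnm_lepP a _] /mnm_lepP b].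
apply/mnm_lepP => j; move: (a j) (b j); rewrite !mnmBE !mnmDE; lia.
Qed.

Let std_add al :
  [pred F | std M al F && ~~ P al F] =1 std (add_gen M f) al.
Proof. by move=> F /=; rewrite /std /P /add_gen negb_or andbA. Qed.

Lemma reg_bound_split d r :
  reg_bound (colon M f) (d + mdeg f) r -> reg_bound (add_gen M f) d r ->
  reg_bound M d r.
Proof.
move=> b1 b2 al i lt; apply: (@acyclic_mid K n _ (P al)).
- exact: convex_std.
- exact: subP.
- have [le|nle] := boolP (f <= al)%MM.
    rewrite -(submK le); apply: eq_acyclic (b1 (al - f)%MM i _).
      by move=> F; rewrite -std_colon.
    have := mdegD (al - f) f; rewrite submK //; lia.
  apply: acyclic_empty => F /andP[_ /= h]; case/negP: nle.
  exact: lepm_trans h (lem_subr _ _).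
apply: eq_acyclic (b2 al i lt) => F; by rewrite -std_add.
Qed.

(** The connecting map comes from one homological degree higher, hence [d.+1] for [(M,f)]. *)
Lemma reg_bound_colon d r :
  reg_bound M d r -> reg_bound (add_gen M f) d.+1 r ->
  reg_bound (colon M f) (d + mdeg f) r.
Proof.
move=> b1 b2 al i lt; apply: eq_acyclic (std_colon al) _.
apply: acyclic_sub.
- exact: convex_std.
- exact: subP.
- by apply: b1; rewrite mdegD; lia.
apply: eq_acyclic (b2 (al + f)%MM i.+1 _) => [F|]; first by rewrite -std_add.
by rewrite mdegD; lia.
Qed.

Lemma indep_trunc x al F : indep M x -> x \notin F -> 0 < al x ->
  std M al (x |: F) = std M al F.
Proof.
move=> iM xF ax; rewrite /std.
have le : (set_mnm (x |: F) <= al)%MM = (set_mnm F <= al)%MM.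
  apply/idP/idP; first exact: std_leU.
  move/mnm_lepP => le; apply/mnm_lepP => j; have := le j.
  by rewrite !set_mnmE !inE; case: eqVneq => [->|].
rewrite le; case: (boolP (set_mnm F <= al)%MM) => // /mnm_lepP leF.
rewrite !andTb; congr (~~ _); rewrite -iM; congr (M _); apply/mnmP => j.
rewrite !mnmE !inE; have := leF j; rewrite set_mnmE; have [->|_] := eqVneq j x.
  by rewrite ?eqxx (negbTE xF) /=; lia.
by rewrite addn0.
Qed.

(** The strand is a cone over [x], so homology only lives in multidegrees free of [x]. *)
Lemma acyclic_indep x al i : indep M x -> 0 < al x -> acyclic K (std M al) i.
Proof.
by move=> iM ax; apply: (@acyclic_cone K n _ x) => F xF; apply: indep_trunc.
Qed.

(* If [f] is a nonzerodivisor on [S/M], then the connecting map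
   [H_(i+1)(S/(M,f)) -> H_i(S/M)(-deg f)] is onto. *)
Lemma reg_bound_nzd x d r : colon M f =1 M -> indep M x -> 0 < f x ->
  reg_bound (add_gen M f) d r ->
  forall be i, i.+1 + r < mdeg be + mdeg f + d -> acyclic K (std M be) i.
Proof.
move=> cM iM fx b be i lt; apply: eq_acyclic (eq_std be cM) _.
apply: eq_acyclic (std_colon be) _; apply: acyclic_sub.
- exact: convex_std.
- exact: subP.
(* The variable [x] divides [f], so the strand of [M] at [be + f] is acyclic in every homological
   degree. *)
- by apply: acyclic_indep iM _; rewrite mnmDE addn_gt0 fx orbT.
apply: eq_acyclic (b (be + f)%MM i.+1 _) => [F|]; first by rewrite -std_add.
by rewrite mdegD; lia.
Qed.

End ColonSequence.

(** In multidegree zero the only face is the empty one, and the class of [1] is not a boundary. *)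
Lemma acyclic_std0 M : ~~ M 0%MM -> ~ acyclic K (std M 0) 0.
Proof.
move=> M0 a; have s0 : set_mnm set0 = 0%MM.
  by apply/mnmP => j; rewrite set_mnmE mnm0E inE.
have V0 : std M 0 set0.
  by rewrite /std s0 lepm_refl; rewrite subm0.
have le0 F : std M 0 F -> F = set0.
  move=> /andP[/mnm_lepP h _]; apply/setP => j; move: (h j).
  by rewrite set_mnmE mnm0E inE; case: (j \in F).
have [F|G VG|v sv bv] := a (fun F => ((F == set0)%:R : K)%R).
- by case: (eqVneq F set0) => [->|]; rewrite ?cards0 ?eqxx ?V0.
- apply: koszul_bd_eq0 => k kG; case: eqVneq => // /setP/(_ k).
  by rewrite !inE eqxx.
move/eqP: (bv _ V0); rewrite eqxx koszul_bd_eq0 => [|k kG].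
  by rewrite eq_sym oner_eq0.
apply/eqP; apply: contraT => /sv /andP[/le0 e]; by rewrite e cards0.
Qed.

Lemma reg_bound_nzd_shift M f x d r :
  up_closed M -> colon M f =1 M -> indep M x -> 0 < f x ->
  reg_bound (add_gen M f) d r -> reg_bound M (d + (mdeg f).-1) r.
Proof.
move=> upM cM iM fx b be i lt; apply: (reg_bound_nzd upM cM iM fx b).
suff : 0 < mdeg f by lia.
by rewrite mdegE (bigD1 x) //= addn_gt0 fx.
Qed.

Lemma reg_bound_ge M d r : ~~ M 0%MM -> reg_bound M d r -> d <= r.
Proof.
move=> M0 b; rewrite leqNgt; apply/negP => lt.
by apply: (acyclic_std0 M0); apply: b; rewrite mdeg0.
Qed.

(* The cone over [x] relates the strand of [(M, x)] in a multidegree with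
   [al x = 1] to the strand of [M] in multidegree [al - x]. *)
Lemma reg_bound_add_var M x d r : up_closed M ->
  reg_bound M d r -> reg_bound (add_gen M U_(x)%MM) d r.
Proof.
move=> upM b al i lt.
(* Setting the exponent of [x] to zero replaces [M] by an ideal [M0] that is independent of [x] and
   agrees with [M] modulo [x]. *)
pose z m : 'X_{1..n} := [multinom if j == x then 0 else m j | j < n].
have zE m j : z m j = if j == x then 0 else m j by rewrite mnmE.
pose M0 : pred 'X_{1..n} := fun m => M (z m).
have zx m : m x = 0 -> z m = m.
  by move=> mx; apply/mnmP => j; rewrite zE; case: eqVneq => // ->.
have upM0 : up_closed M0.
  move=> m m' /mnm_lepP le; apply: upM; apply/mnm_lepP => j; rewrite !zE.
  by case: ifP.
have iM0 : indep M0 x.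
  move=> m; rewrite /M0; congr M; apply/mnmP => j.
  rewrite !zE mnmDE mnm1E eq_sym; case: eqVneq => //= _; exact: addn0.
have addE : add_gen M0 U_(x)%MM =1 add_gen M U_(x)%MM.
  move=> m; rewrite /add_gen lep1mP; have [m0|] := eqVneq (m x) 0.
    by rewrite /M0 zx.
  by rewrite !orbT.
have base be j : be x = 0 -> j + r < mdeg be + d ->
    acyclic K (std M0 be) j.
  move=> bx ltj; apply: eq_acyclic (b be j ltj) => F.
  by rewrite /std /M0 zx // mnmBE bx.
apply: eq_acyclic (eq_std al addE) _.
(* For exponent 0 the strands of [(M,x)] and [M] agree. For exponent 1 the connecting map is used.
   For exponent at least 2 the monomials are all divisible by [x], and the strand is empty. *)
case ax: (al x) => [|[|k]].
- apply: eq_acyclic (base al i ax lt) => F.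
  by rewrite /std /add_gen lep1mP mnmBE ax orbF.
- case: i lt => [|i] lt.
    apply: acyclic_empty => F /andP[_]; rewrite /add_gen lep1mP mnmBE ax set_mnmE.
    by rewrite negb_or negbK cards_eq0 => /andP[_ xF]; apply/eqP => F0; rewrite F0 inE in xF.
  pose P F := (U_(x) <= al - set_mnm F)%MM.
  apply: (@eq_acyclic K n [pred F | std M0 al F && ~~ P F]).
    by move=> F /=; rewrite /std /P /add_gen negb_or andbA.
  apply: acyclic_quo.
  + exact: convex_std.
  + by move=> k G _ _ h; apply: lepm_trans h (sub_std_leU _ _ _).
  + have le : (U_(x) <= al)%MM by rewrite lep1mP ax.
    have mE := mdegD (al - U_(x))%MM U_(x)%MM; rewrite submK // mdeg1 in mE.
    have a0 : (al - U_(x))%MM x = 0 by rewrite mnmBE mnm1E eqxx ax.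
    apply: eq_acyclic (base (al - U_(x))%MM i a0 _); last by lia.
    move=> F; rewrite /= /std /P lep1mP !mnmBE ax set_mnmE.
    case xF: (x \in F) => /=.
      rewrite andbF; apply/negbTE; apply/negP => /andP[/mnm_lepP/(_ x)].
      by rewrite set_mnmE xF a0.
    rewrite andbT; congr (_ && _).
      apply/mnm_lepP/mnm_lepP => h j; have := h j; rewrite set_mnmE mnmBE mnm1E; first by lia.
      by have [<-|] := eqVneq x j; rewrite ?xF // subn0.
    congr (~~ M _); apply/mnmP => j; rewrite !zE; case: eqVneq => // jx.
    by rewrite !mnmBE mnm1E eq_sym (negbTE jx) subn0.
  by apply: acyclic_indep iM0 _; rewrite ax.
apply: acyclic_empty => F /andP[_]; rewrite /add_gen lep1mP mnmBE ax set_mnmE.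
by case: (x \in F); rewrite negb_or andbF.
Qed.

Lemma reg_bound_del_var M x d r : indep M x ->
  reg_bound (add_gen M U_(x)%MM) d r -> reg_bound M d r.
Proof.
move=> iM b al i lt; case ax: (al x) => [|k].
  apply: eq_acyclic (b al i lt) => F.
  by rewrite /std /add_gen lep1mP mnmBE ax orbF.
by apply: acyclic_indep iM _; rewrite ax.
Qed.

Lemma indepM M x m k : indep M x -> M (m + U_(x) *+ k)%MM = M m.
Proof.
move=> iM; elim: k => [|k IH]; first by rewrite mulm0n addm0.
by rewrite mulmSr addmA iM.
Qed.

End MonomialRegularity.

(** * Powers of monomial ideals and leaves *)

Section MonomialPowers.
Variables (K : fieldType) (n : nat).
Implicit Types (E : seq 'X_{1..n}) (e g m : 'X_{1..n}) (x y z : 'I_n).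
Implicit Types (t d r : nat).

(** Generators are peeled off one at a time, so that induction on [t] needs no list of products. *)
Fixpoint in_pow E t : pred 'X_{1..n} := fun m =>
  if t is t'.+1 then has (fun g => (g <= m)%MM && in_pow E t' (m - g)%MM) E
  else true.

Lemma up_closed_in_pow E t : up_closed (in_pow E t).
Proof.
elim: t => //= t IH m m' le /hasP[g gE /andP[gm h]]; apply/hasP; exists g => //.
rewrite (lepm_trans gm le); apply: IH h; apply/mnm_lepP => j.
by rewrite !mnmBE leq_sub2r // (mnm_lepP le).
Qed.

Lemma in_pow_sub E E' t m :
  {subset E' <= E} -> in_pow E' t m -> in_pow E t m.
Proof.
move=> sub; elim: t m => //= t IH m /hasP[g gE /andP[gm h]].
by apply/hasP; exists g; rewrite ?sub // gm IH.
Qed.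

Lemma eq_in_pow E E' t : E =i E' -> in_pow E t =1 in_pow E' t.
Proof. by move=> e m; apply/idP/idP; apply: in_pow_sub => g; rewrite e. Qed.

Lemma in_pow_filter (a : pred 'X_{1..n}) E t m :
  (forall g, g \in E -> (g <= m)%MM -> a g) ->
  in_pow E t m = in_pow (filter a E) t m.
Proof.
move=> am; apply/idP/idP; last first.
  by apply: in_pow_sub => g; rewrite mem_filter => /andP[].
elim: t m am => //= t IH m am /hasP[g gE /andP[gm h]].
apply/hasP; exists g; first by rewrite mem_filter am.
rewrite gm IH // => g' g'E le; apply: am => //.
exact: lepm_trans le (lem_subr _ _).
Qed.

Lemma in_pow_indep E t x : (forall g, g \in E -> g x = 0) -> indep (in_pow E t) x.
Proof.
move=> E0; elim: t => //= t IH m; apply: eq_in_has => g gE.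
have le : (g <= m + U_(x))%MM = (g <= m)%MM.
  apply/mnm_lepP/mnm_lepP => h j; have := h j; rewrite mnmDE mnm1E.
    by case: eqVneq => [<-|]; rewrite ?addn0 // E0.
  by move/leq_trans; apply; rewrite leq_addr.
rewrite le; case: (boolP (g <= m)%MM) => //= gm.
rewrite -(IH (m - g)%MM); congr in_pow; apply/mnmP => j; rewrite !mnmE.
have := mnm_lepP gm j; lia.
Qed.

Lemma in_pow1 E m : in_pow E 1 m = has (fun g => (g <= m)%MM) E.
Proof. by apply: eq_has => g; rewrite andbT. Qed.

Lemma in_pow1_cons e E : in_pow (e :: E) 1 =1 add_gen (in_pow E 1) e.
Proof. by move=> m; rewrite /add_gen !in_pow1 orbC. Qed.

(* Removing an unweighted leaf edge [xy]: a generator dividing [m x y] but not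
   [m] exhausts the power of [y], so the other factors avoid both [x] and [y]. *)
Lemma colon_leaf E x y t : x != y -> (forall g, g \in E -> g x = 0) ->
  colon (in_pow ((U_(x) + U_(y))%MM :: E) t.+1) (U_(x) + U_(y))%MM
  =1 in_pow ((U_(x) + U_(y))%MM :: E) t.
Proof.
set e := (U_(x) + U_(y))%MM => xy E0 m; rewrite /colon.
have eE j : e j = (x == j) + (y == j) by rewrite mnmDE !mnm1E.
have e_x : e x = 1 by rewrite eE eqxx eq_sym (negbTE xy).
have e_y : e y = 1 by rewrite eE eqxx (negbTE xy).
apply/idP/idP; last by move=> h; rewrite /= lem_addl addmK h.
elim: t m => // t IH m /hasP[g]; rewrite inE => /predU1P[-> /andP[_]|gE].
  by rewrite addmK.
case/andP=> gme h; have [gm|ngm] := boolP (g <= m)%MM.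
  apply/hasP; exists g; first by rewrite inE gE orbT.
  rewrite gm /=; apply: IH; rewrite -[in X in is_true X](_ : (m + e - g)%MM = (m - g + e)%MM) //.
  apply/mnmP => j; rewrite !mnmE; have := mnm_lepP gm j; lia.
(* Since [g] is free of [x], it can fail to divide [m] only at [y], and there by exactly one. *)
have [gy oth] : g y = m y + 1 /\ (m + e - g <= m + U_(x))%MM.
  have: exists j, m j < g j.
    have /forallPn[j] : ~~ [forall j, g j <= m j] by [].
    by rewrite -ltnNge; exists j.
  case=> j lt; have := mnm_lepP gme j; rewrite mnmDE eE.
  have nx : x != j by apply: contraTneq lt => <-; rewrite (E0 _ gE) ltn0.
  rewrite (negbTE nx); case: (eqVneq y j) => [yj|]; last by lia.
  move=> le; subst j; split; first by lia.
  apply/mnm_lepP => k; rewrite !mnmE; case: (eqVneq y k) => [<-|]; lia.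
have y0 : (m + e - g)%MM y = 0 by rewrite mnmBE mnmDE e_y gy; lia.
have {h}: in_pow (e :: E) t.+1 (m + e - g)%MM by exact: h.
rewrite (@in_pow_filter (fun g => g y == 0) _ _ (m + e - g)%MM); last first.
  by move=> g' _ /mnm_lepP/(_ y); rewrite y0 leqn0.
move/(up_closed_in_pow oth); rewrite in_pow_indep.
  by apply: in_pow_sub => g'; rewrite mem_filter => /andP[].
move=> g'; rewrite mem_filter inE => /andP[g'y /predU1P[ge|/E0 //]].
by rewrite ge e_y in g'y.
Qed.

Section Leaf.
Variables (E : seq 'X_{1..n}) (x y : 'I_n) (t d r : nat).
Hypotheses (xy : x != y) (E0 : forall g, g \in E -> g x = 0).
Let e := (U_(x) + U_(y))%MM.
Let E2 := [seq g : 'X_{1..n} <- E | g y == 0].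

(* The remaining step, bounding the colon by [y], depends on the edge at [y]. *)
Let leaf_split :
  reg_bound K (in_pow (e :: E) t) (d + 2) r ->
  reg_bound K (in_pow E2 t.+1) d r ->
  reg_bound K (colon (in_pow E t.+1) U_(y)%MM) d.+1 r ->
  reg_bound K (in_pow (e :: E) t.+1) d r.
Proof.
move=> b1 b2 b3.
have up E' k := @up_closed_in_pow E' k.
have eE j : e j = (x == j) + (y == j) by rewrite mnmDE !mnm1E.
apply: (reg_bound_split (f := e)) => //.
  rewrite mdegD !mdeg1; apply: eq_reg_bound b1 => m; apply/esym; exact: colon_leaf.
(* A monomial not divisible by [e] lies in the power only through factors from [E]. *)
apply: (@eq_reg_bound K n (add_gen (in_pow E t.+1) e)).
  move=> m; rewrite /add_gen; have [|ne] := boolP (e <= m)%MM; first by rewrite !orbT.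
  rewrite !orbF; symmetry; rewrite (@in_pow_filter (fun g => g != e)); last first.
    by move=> g _ gm; apply: contraNneq ne => <-.
  apply: eq_in_pow => g; rewrite mem_filter inE; case: eqVneq => //= ->.
  apply/esym/negbTE/negP => /E0; rewrite eE eqxx; lia.
(* Dividing by [y] turns [e] into [x]; killing [y] leaves the generators free of [y]. *)
apply: (reg_bound_split (f := U_(y)%MM)); first exact: up_closed_add_gen.
  rewrite mdeg1 addn1.
  apply: (@eq_reg_bound K n (add_gen (colon (in_pow E t.+1) U_(y)%MM) U_(x)%MM)).
    move=> m; rewrite /add_gen /colon; congr (_ || _); rewrite lep1mP.
    apply/idP/idP => [mx|/mnm_lepP/(_ x)].
      apply/mnm_lepP => j; rewrite eE mnmDE mnm1E.
      by case: (eqVneq x j) mx => [<-|_] ?; lia.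
    by rewrite eE mnmDE mnm1E eqxx; lia.
  by apply: reg_bound_add_var => //; apply: up_closed_colon.
apply: (@eq_reg_bound K n (add_gen (in_pow E2 t.+1) U_(y)%MM)); last first.
  exact: reg_bound_add_var.
move=> m; rewrite /add_gen lep1mP; have [my|] := eqVneq (m y) 0; last by rewrite !orbT.
rewrite !orbF -(@in_pow_filter (fun g => g y == 0)); last first.
  by move=> g _ /mnm_lepP/(_ y); rewrite my leqn0.
suff /negbTE -> : ~~ (e <= m)%MM by rewrite orbF.
by apply/negP => /mnm_lepP/(_ y); rewrite eE eqxx my; lia.
Qed.

(** The colon by [y] is bounded through the exact sequence, so only powers of [E] and of its
    generators avoiding [y] enter. *)
Lemma reg_bound_leaf :
  reg_bound K (in_pow (e :: E) t) (d + 2) r ->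
  reg_bound K (in_pow E t.+1) d r ->
  reg_bound K (in_pow E2 t.+1) d.+1 r ->
  reg_bound K (in_pow (e :: E) t.+1) d r.
Proof.
move=> b1 b2 b3; apply: leaf_split => //; first by apply: reg_bound_weaken b3; lia.
rewrite -[d.+1]addn1 -(mdeg1 y); apply: reg_bound_colon => //.
  exact: up_closed_in_pow.
apply: (@eq_reg_bound K n (add_gen (in_pow E2 t.+1) U_(y)%MM)); last first.
  by apply: reg_bound_add_var => //; apply: up_closed_in_pow.
move=> m; rewrite /add_gen lep1mP; have [my|] := eqVneq (m y) 0; last by rewrite !orbT.
rewrite !orbF -(@in_pow_filter (fun g => g y == 0)) //.
by move=> g _ /mnm_lepP/(_ y); rewrite my leqn0.
Qed.

(** If the next edge [yz] is unweighted too, the colon by [y] is split at [z]: its colon by [z] is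
    the lower power of [E], and killing [z] removes [y] as well. *)
Lemma reg_bound_leaf2 E' z : y != z -> E = (U_(y) + U_(z))%MM :: E' ->
  (forall g, g \in E' -> g y = 0) ->
  reg_bound K (in_pow (e :: E) t) (d + 2) r ->
  reg_bound K (in_pow E t) (d + 2) r ->
  reg_bound K (in_pow E' t.+1) d r ->
  reg_bound K (in_pow [seq g : 'X_{1..n} <- E' | g z == 0] t.+1) d.+1 r ->
  reg_bound K (in_pow (e :: E) t.+1) d r.
Proof.
move=> yz EE E'0 b1 b2 b3 b4; apply: leaf_split => //.
  apply: eq_reg_bound b3; apply: eq_in_pow => g.
  rewrite mem_filter EE inE; case: (eqVneq g) => [->|_] /=.
    rewrite mnmDE !mnm1E eqxx /=; apply/negbTE/negP => /E'0.
    by rewrite mnmDE !mnm1E eqxx.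
  by case: (boolP (g \in E')) => [/E'0 ->|]; rewrite ?andbF.
apply: (reg_bound_split (f := U_(z)%MM)).
- by apply: up_closed_colon; apply: up_closed_in_pow.
- rewrite mdeg1; have := b2; rewrite addn2 addn1; apply: eq_reg_bound => m.
  rewrite /colon -addmA [(U_(z) + _)%MM]addmC EE; apply/esym; exact: colon_leaf.
set E3 := filter _ _ in b4.
apply: (@eq_reg_bound K n (add_gen (in_pow E3 t.+1) U_(z)%MM)); last first.
  by apply: reg_bound_add_var => //; apply: up_closed_in_pow.
move=> m; rewrite /add_gen lep1mP; have [mz|] := eqVneq (m z) 0; last by rewrite !orbT.
rewrite !orbF /colon [RHS](@in_pow_filter (fun g => g z == 0)); last first.
  move=> g _ /mnm_lepP/(_ z); rewrite mnmDE mz mnm1E (negbTE yz).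
  by rewrite leqn0.
rewrite EE /= mnmDE !mnm1E eqxx addn1 /=.
apply/esym; rewrite -[RHS](@in_pow_indep E3 t.+1 y) //.
by move=> g; rewrite mem_filter => /andP[_ /E'0].
Qed.

End Leaf.

Lemma reg_bound_zero t d r : d <= r -> reg_bound K (in_pow [::] t) d r.
Proof.
move=> dr; case: t => [|t]; first exact: reg_bound_unit.
move=> al i lt; case: (pickP (fun x => 0 < al x)) => [x ax|a0].
  by apply: (@acyclic_indep K n _ x) => //.
suff : mdeg al = 0 by lia.
by rewrite mdegE big1 // => j _; move: (a0 j); case: (al j).
Qed.

(** Killing [x] discards the generators involving it; the result is independent of [x], so [x] can
    be freed again. *)
Lemma reg_bound_restrict E t x d r :
  reg_bound K (in_pow E t) d r ->
  reg_bound K (in_pow [seq g : 'X_{1..n} <- E | g x == 0] t) d r.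
Proof.
move=> b; set E' := filter _ _.
apply: (@reg_bound_del_var K n _ x).
  by apply: in_pow_indep => g; rewrite mem_filter => /andP[/eqP].
apply: (@eq_reg_bound K n (add_gen (in_pow E t) U_(x)%MM)); last first.
  by apply: reg_bound_add_var => //; apply: up_closed_in_pow.
move=> m.
rewrite /add_gen lep1mP; have [mx|] := eqVneq (m x) 0; last by rewrite !orbT.
rewrite !orbF -(@in_pow_filter (fun g => g x == 0)) //.
by move=> g _ /mnm_lepP/(_ x); rewrite mx leqn0.
Qed.

End MonomialPowers.

(** * Weighted paths *)

Section WeightedPaths.
Variables (K : fieldType) (n : nat).
Implicit Types (s : seq 'I_n) (ws : seq nat) (x y z : 'I_n) (m g : 'X_{1..n}).
Implicit Types (t d r w W : nat).

Definition edge x y w : 'X_{1..n} := ((U_(x) + U_(y)) *+ w)%MM.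

Fixpoint path_gens s ws : seq 'X_{1..n} :=
  match s, ws with
  | x :: ((y :: _) as s'), w :: ws' => edge x y w :: path_gens s' ws'
  | _, _ => [::]
  end.

Arguments path_gens : simpl never.

Lemma path_gens_cons x y s w ws :
  path_gens (x :: y :: s) (w :: ws) = edge x y w :: path_gens (y :: s) ws.
Proof. by []. Qed.

(* Predecessor truncation lets the empty vertex list carry the empty weight list. *)
Definition path_wf s ws :=
  [&& uniq s, all (leq 1) ws & size ws == (size s).-1].

Definition path_reg s ws t d r := reg_bound K (in_pow (path_gens s ws) t) d r.

(* [reg (S/I^(t+1)) <= reg (S/I) + 2 t W] for all paths with weights [ws]. *)
Definition linear_bound W ws := forall s, path_wf s ws -> forall t d r,
  path_reg s ws 1 d r -> path_reg s ws t.+1 d (r + 2 * t * W).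

Lemma edgeE x y w j : edge x y w j = ((x == j) + (y == j)) * w.
Proof. by rewrite mulmnE mnmDE !mnm1E. Qed.

Lemma edgeC x y w : edge x y w = edge y x w.
Proof. by rewrite /edge addmC. Qed.

Lemma mdeg_edge x y w : mdeg (edge x y w) = 2 * w.
Proof. by rewrite mdegMn mdegD !mdeg1. Qed.

Lemma path_gens_nil s : path_gens s [::] = [::].
Proof. by case: s => [|x []]. Qed.

Lemma path_gens_notin s ws x g : x \notin s -> g \in path_gens s ws -> g x = 0.
Proof.
elim: s ws => // y [|z s] IH [|w ws] //; rewrite inE => /norP[xy xs].
rewrite path_gens_cons inE => /predU1P[->|/IH -> //].
move: xs; rewrite inE => /norP[xz _].
by rewrite edgeE ![_ == x]eq_sym (negbTE xy) (negbTE xz).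
Qed.

Lemma path_gens_pos s ws g : all (leq 1) ws -> g \in path_gens s ws -> 0 < mdeg g.
Proof.
elim: s ws => // y [|z s] IH [|w ws] // /= /andP[w0 w1].
rewrite path_gens_cons inE => /predU1P[->|/IH -> //]; rewrite mdeg_edge; lia.
Qed.

Lemma path_wf_behead x s ws : path_wf (x :: s) ws -> path_wf s (behead ws).
Proof.
case/and3P=> /= /andP[_ us] aw /eqP sz; rewrite /path_wf us.
case: ws aw sz => [|w ws] /=; first by move=> _ <-.
by move=> /andP[_ ->] <- /=.
Qed.

Lemma path_gens_behead y s ws : path_wf (y :: s) ws ->
  [seq g : 'X_{1..n} <- path_gens (y :: s) ws | g y == 0] = path_gens s (behead ws).
Proof.
case: s ws => [|z s] [|w ws] //; first by rewrite !path_gens_nil.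
case/and3P=> /andP[ys _] /andP[w0 _] _.
rewrite path_gens_cons /= edgeE eqxx mulnDl mul1n addn_eq0 [w == 0]eqn0Ngt w0 /=.
rewrite (eq_in_filter (a2 := predT)) ?filter_predT // => g.
by move/(path_gens_notin ys) => ->.
Qed.

Lemma path_reg_behead x s ws t d r : path_wf (x :: s) ws ->
  path_reg (x :: s) ws t d r -> path_reg s (behead ws) t d r.
Proof. by move=> wf /(@reg_bound_restrict _ _ _ _ x); rewrite path_gens_behead. Qed.

Lemma path_reg_weaken s ws t d r d' r' :
  r + d' <= r' + d -> path_reg s ws t d r -> path_reg s ws t d' r'.
Proof. exact: reg_bound_weaken. Qed.

Lemma path_reg_leaf x y s ws t d r : path_wf (x :: y :: s) (1 :: ws) ->
  path_reg (x :: y :: s) (1 :: ws) t (d + 2) r ->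
  path_reg (y :: s) ws t.+1 d r ->
  path_reg s (behead ws) t.+1 d.+1 r ->
  path_reg (x :: y :: s) (1 :: ws) t.+1 d r.
Proof.
move=> wf b1 b2 b3; have wf' := path_wf_behead wf.
have /and3P[/= /andP[xs _] _ _] := wf.
apply: (@reg_bound_leaf _ _ (path_gens (y :: s) ws)) => //.
- by move: xs; rewrite inE => /norP[].
- by move=> g; apply: path_gens_notin.
by rewrite path_gens_behead.
Qed.

Lemma path_reg_leaf2 x y z s ws t d r :
  path_wf (x :: y :: z :: s) (1 :: 1 :: ws) ->
  path_reg (x :: y :: z :: s) (1 :: 1 :: ws) t (d + 2) r ->
  path_reg (y :: z :: s) (1 :: ws) t (d + 2) r ->
  path_reg (z :: s) ws t.+1 d r ->
  path_reg s (behead ws) t.+1 d.+1 r ->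
  path_reg (x :: y :: z :: s) (1 :: 1 :: ws) t.+1 d r.
Proof.
move=> wf b1 b2 b3 b4; have wf' := path_wf_behead (path_wf_behead wf).
have /and3P[/= /and3P[xs ys _] _ _] := wf.
apply: (@reg_bound_leaf2 _ _ (path_gens (y :: z :: s) (1 :: ws)) _ _ _ _ _ _ _
  (path_gens (z :: s) ws) z) => //.
- by move: xs; rewrite inE => /norP[].
- by move=> g; apply: path_gens_notin.
- by move: ys; rewrite inE => /norP[].
- by move=> g; apply: path_gens_notin.
by rewrite path_gens_behead.
Qed.

Lemma path_reg_first x y s ws w d r : path_wf (x :: y :: s) (w :: ws) ->
  path_reg (x :: y :: s) (w :: ws) 1 d r ->
  path_reg (behead s) (behead (behead ws)) 1 (d + (2 * w).-1) r.
Proof.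
move=> wf b; have wf' := path_wf_behead wf.
have /and3P[/= /and3P[xs ys us] /andP[w0 aw] sz] := wf.
move: xs; rewrite inE => /norP[xy xs].
have bL : reg_bound K
    (in_pow (edge x y w :: path_gens (behead s) (behead (behead ws))) 1) d r.
  case: s ws wf wf' b xs ys sz aw {us} => [|z s] ws wf wf' b xs ys sz aw.
    by move: b; rewrite /path_reg; case: ws sz {wf wf' aw}.
  (* Killing the neighbour [z] of [y] separates the first edge from the rest, leaving disjoint sets
     of variables. *)
  have := @reg_bound_restrict _ _ _ _ z _ _ b; congr (reg_bound _ (in_pow _ _) _ _).
  move: xs ys; rewrite !inE => /norP[xz _] /norP[yz _].
  rewrite path_gens_cons /= edgeE (negbTE xz) (negbTE yz) mul0n eqxx; congr (_ :: _).
  case: ws wf wf' sz aw {b} => [|w2 ws] // wf wf' sz /andP[w20 aw].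
  have /path_gens_behead <- := path_wf_behead wf'.
  by rewrite path_gens_cons /= edgeE eqxx (negbTE yz) mul1n eqn0Ngt w20.
rewrite /path_reg; set L := path_gens _ _ in bL *.
have Lx g u : u \notin s -> g \in L -> g u = 0.
  by move=> us'; apply: path_gens_notin; apply: contra us' => /mem_behead.
have M : reg_bound K (add_gen (in_pow L 1) (edge x y w)) d r.
  by apply: eq_reg_bound bL; apply: in_pow1_cons.
rewrite -(mdeg_edge x y w); apply: (@reg_bound_nzd_shift K n _ _ x) M.
- exact: up_closed_in_pow.
- move=> m; rewrite /colon (_ : edge x y w = (U_(x) *+ w + U_(y) *+ w)%MM).
    rewrite addmA !indepM //; apply: in_pow_indep => g; exact: Lx.
  by apply/mnmP => j; rewrite edgeE mnmDE !mulmnE !mnm1E mulnDl.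
- by apply: in_pow_indep => g; apply: Lx.
by rewrite edgeE eqxx muln_gt0 w0.
Qed.

Lemma path_reg_ge s ws d r : path_wf s ws -> path_reg s ws 1 d r -> d <= r.
Proof.
case/and3P=> _ aw _; apply: reg_bound_ge; rewrite in_pow1.
apply/hasPn => g /(path_gens_pos aw) g0; apply: contraL g0 => /mnm_lepP h.
rewrite -leqNgt leqn0 mdeg_eq0; apply/eqP/mnmP => j.
by apply/eqP; rewrite mnm0E -leqn0 -(mnm0E j).
Qed.

Lemma path_reg_first_ge x y s ws w d r : path_wf (x :: y :: s) (w :: ws) ->
  path_reg (x :: y :: s) (w :: ws) 1 d r -> d + (2 * w).-1 <= r.
Proof.
move=> wf /(path_reg_first wf); apply: path_reg_ge.
have := path_wf_behead (path_wf_behead wf).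
case: (s) => [|z s'] /=; last exact: path_wf_behead.
by case/and3P=> _; case: (behead ws).
Qed.

Lemma linear_bound_nil W : linear_bound W [::].
Proof.
move=> s wf t d r b; apply: (@path_reg_weaken s [::] t.+1 d r); first by lia.
by move: b; rewrite /path_reg path_gens_nil; apply: eq_reg_bound.
Qed.

Lemma path_wf_cons s w ws : path_wf s (w :: ws) ->
  exists x y s', s = x :: y :: s'.
Proof.
by case: s => [|x [|y s']] /and3P[] // _ _ _; exists x, y, s'.
Qed.

(** Raising the exponent by one gains [2 * W >= 2], which pays for the degree of the leaf edge. *)
Lemma linear_bound_leaf2 W ws : 0 < W -> linear_bound W (1 :: ws) ->
  linear_bound W ws -> linear_bound W (behead ws) -> linear_bound W (1 :: 1 :: ws).
Proof.
move=> W0 c1 c2 c3 s wf; have [x [y [s1 e]]] := path_wf_cons wf.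
have wf1 : path_wf (y :: s1) (1 :: ws) by move: wf; rewrite e; apply: path_wf_behead.
have [y' [z [s' [_ e1]]]] := path_wf_cons wf1; subst s1 s.
have wf2 := path_wf_behead wf1; have wf3 := path_wf_behead wf2.
elim=> [|t IH] d r b; first by apply: path_reg_weaken b; lia.
have b1 := path_reg_behead wf b; have b2 := path_reg_behead wf1 b1.
(* The first edge contributes [2 * 1 - 1 = 1], the shift [d.+1] required of the last path. *)
have b3 := path_reg_first wf b.
apply: path_reg_leaf2 => //.
- by apply: path_reg_weaken (IH _ _ b); nia.
- by apply: path_reg_weaken (c1 _ wf1 t _ _ b1); nia.
- by apply: path_reg_weaken (c2 _ wf2 t.+1 _ _ b2); nia.
by apply: path_reg_weaken (c3 _ wf3 t.+1 _ _ b3); nia.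
Qed.

(** Here the path needing the shift [d.+1] starts right after [y], one vertex earlier than
    [path_reg_first] reaches; the shift is therefore left as a hypothesis. *)
Lemma linear_bound_leaf W ws : 0 < W -> linear_bound W ws ->
  (forall x y s, path_wf (x :: y :: s) (1 :: ws) -> forall t d r,
     path_reg (x :: y :: s) (1 :: ws) 1 d r ->
     path_reg s (behead ws) t.+2 d.+1 (r + 2 * t.+1 * W)) ->
  linear_bound W (1 :: ws).
Proof.
move=> W0 c1 c2 s wf; have [x [y [s' e]]] := path_wf_cons wf; subst s.
have wf1 := path_wf_behead wf.
elim=> [|t IH] d r b; first by apply: path_reg_weaken b; lia.
apply: path_reg_leaf => //.
- by apply: path_reg_weaken (IH _ _ b); nia.
- exact: c1 (path_reg_behead wf b).
exact: c2 b.
Qed.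

Lemma linear_bound_unweighted W k : 0 < W -> linear_bound W (nseq k 1).
Proof.
move=> W0; elim/ltn_ind: k => -[_|[_|k IH]]; first exact: linear_bound_nil.
  apply: linear_bound_leaf => //; first exact: linear_bound_nil.
  move=> x y s wf t d r /(path_reg_first_ge wf) le.
  by rewrite /path_reg path_gens_nil; apply: reg_bound_zero; lia.
apply: linear_bound_leaf2 => //; [exact: (IH k.+1)|exact: (IH k)|].
case: k IH => [|k] IH; first exact: linear_bound_nil.
by apply: (IH k); lia.
Qed.

(* Unweighted arms are stripped leaf by leaf; only the edge next to the core
   [a :: c] needs the extra hypothesis. *)
Lemma linear_bound_arm W a c i : 0 < W ->
  linear_bound W (a :: c) -> linear_bound W c ->
  (forall x y s, path_wf (x :: y :: s) [:: 1, a & c] -> forall t d r,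
     path_reg (x :: y :: s) [:: 1, a & c] 1 d r ->
     path_reg s c t.+2 d.+1 (r + 2 * t.+1 * W)) ->
  linear_bound W (nseq i 1 ++ a :: c).
Proof.
move=> W0 c1 c2 c3; elim/ltn_ind: i => -[_ //|[_|i IH]].
  exact: linear_bound_leaf.
apply: linear_bound_leaf2 => //; [exact: (IH i.+1)|exact: (IH i)|].
case: i IH => [|i] IH //.
by apply: (IH i); lia.
Qed.

Lemma path_gens_rcons s x y ws w : size ws = size s ->
  path_gens (rcons (rcons s x) y) (rcons ws w) =
  rcons (path_gens (rcons s x) ws) (edge x y w).
Proof.
elim: s ws => [|z s IH] [|w' ws] // [sz]; have {}IH := IH _ sz.
case: s IH sz => [|z' s] IH sz.
  by case: ws sz {IH}.
by rewrite !rcons_cons in IH *; rewrite !path_gens_cons IH.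
Qed.

Lemma path_gens_rev s ws : size ws = (size s).-1 ->
  path_gens (rev s) (rev ws) =i path_gens s ws.
Proof.
elim: s ws => [|x s IH] ws sz; first by case: ws sz.
case: s IH sz => [|y s] IH sz; first by case: ws sz.
case: ws sz => // w ws [sz] g.
rewrite [rev (x :: _)]rev_cons [rev (y :: _)]rev_cons [rev (w :: _)]rev_cons.
rewrite path_gens_rcons ?size_rev // -rev_cons mem_rcons path_gens_cons !inE IH //.
by rewrite edgeC.
Qed.

(** Lets right arms be treated as left arms. *)
Lemma linear_bound_rev W ws : linear_bound W ws -> linear_bound W (rev ws).
Proof.
move=> c s /and3P[us aw sz] t d r.
have sz' : size ws = (size (rev s)).-1 by rewrite size_rev -(eqP sz) size_rev.
have wf : path_wf (rev s) ws.
  by apply/and3P; rewrite rev_uniq sz'; split => //; rewrite -all_rev.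
have e k : in_pow (path_gens s (rev ws)) k =1 in_pow (path_gens (rev s) ws) k.
  by apply: eq_in_pow => g; rewrite -(path_gens_rev sz') revK.
move=> b; apply: eq_reg_bound (c _ wf t d r _) => [m|]; first by rewrite e.
by apply: eq_reg_bound b.
Qed.

(** The ideal is principal: dividing by [f], of degree [2 * a <= 2 * W], lowers the exponent by one,
    and adding [f] leaves the first power. *)
Lemma linear_bound_edge W a : a <= W -> linear_bound W [:: a].
Proof.
move=> aW s wf; have [x [y [s' e]]] := path_wf_cons wf; subst s.
rewrite /path_reg path_gens_cons path_gens_nil; set f := edge x y a.
elim=> [|t IH] d r b; first by apply: reg_bound_weaken b; lia.
apply: (reg_bound_split (f := f)); first exact: up_closed_in_pow.
  apply: (@eq_reg_bound K n (in_pow [:: f] t.+1)).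
    by move=> m; rewrite /colon [in RHS]/= orbF lem_addl addmK.
  by apply: reg_bound_weaken (IH _ _ b); rewrite mdeg_edge; nia.
apply: (@eq_reg_bound K n (in_pow [:: f] 1)); last by apply: reg_bound_weaken b; lia.
move=> m; rewrite /add_gen in_pow1 /= !orbF.
by case: (f <= m)%MM; rewrite ?orbT.
Qed.

Lemma linear_bound_single_left W a i : 2 <= W -> a <= W ->
  linear_bound W (nseq i 1 ++ [:: a]).
Proof.
move=> W2 aW; apply: linear_bound_arm; first by lia.
- exact: linear_bound_edge.
- exact: linear_bound_nil.
move=> x y s wf t d r /(path_reg_first_ge wf) le.
by rewrite /path_reg path_gens_nil; apply: reg_bound_zero; lia.
Qed.

Lemma linear_bound_single W a i j : 2 <= W -> a <= W ->
  linear_bound W (nseq i 1 ++ a :: nseq j 1).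
Proof.
move=> W2 aW; apply: linear_bound_arm; first by lia.
- have := linear_bound_rev (linear_bound_single_left (i := j) W2 aW).
  by rewrite rev_cat rev_nseq.
- by apply: linear_bound_unweighted; lia.
move=> x y s wf t d r b; have wf1 := path_wf_behead wf.
have b2 := path_reg_behead wf1 (path_reg_behead wf b).
(* The path past the heavy edge satisfies the bound with constant 1; the gap to [W >= 2] absorbs the
   shift [d.+1]. *)
have c := @linear_bound_unweighted 1 j isT.
by apply: path_reg_weaken (c _ (path_wf_behead wf1) t.+1 _ _ b2); nia.
Qed.

End WeightedPaths.
Arguments path_gens {n} s ws : simpl never.

(** * Two heavy edges *)

Section CoreDegree.
Variables (M T : nat).

(* [s, r, c, i] are the exponents of [x, y, v, z] in a monomial outside
   [((xy)^a, yv, (vz)^b)^T]; the factorizations excluded in [step] trade [h]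
   factors [(xy)^a] for [m + h] factors [yv]. *)
Let core_degree_bound_aux a b s r c i k l :
  2 <= a -> 2 <= b -> a <= M -> b <= M -> s <= r -> i <= c -> c <= b * T ->
  (forall k j l, k + j + l = T ->
     ~ [/\ a * k <= s, a * k + j <= r, j + b * l <= c & b * l <= i]) ->
  a * k <= s -> b * l <= i < b * l + b -> k + l < T -> r < a * k + (T - k - l) ->
  s + r + c + i < 2 * M * T.
Proof.
move=> a2 b2 aM bM sr ic cb non ks /andP[li il] lt rm.
pose m := T - k - l; have mE : T = m + k + l by lia.
have step h : h <= k -> a * k + m + h <= r + a * h -> c < b * l + m + h.
  move=> hk hr; rewrite ltnNge; apply/negP => hc.
  case: (non (k - h) (m + h) l); first by lia.
  by split; nia.
pose e := r - a * k; have rE : r = a * k + e by lia.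
(* Trading [m - e] factors repairs the deficit at [y] because [a >= 2]. If there are too few, all
   [k] are traded, provided [r] permits. *)
have [lek|ltk] := leqP (m - e) k.
  have := step (m - e) lek; nia.
have [rk|rk] := ltnP r (m + k); first by nia.
have := step k (leqnn _); nia.
Qed.

(** The inequalities on exponents are those left over once the cone arguments of [reg_bound_core]
    have removed the acyclic strands. *)
Lemma core_degree_bound a b s r c i :
  2 <= a -> 2 <= b -> a <= M -> b <= M ->
  s <= r -> i <= c -> r <= a * T -> c <= b * T ->
  (forall k j l, k + j + l = T ->
     ~ [/\ a * k <= s, a * k + j <= r, j + b * l <= c & b * l <= i]) ->
  s + r + c + i < 2 * M * T.
Proof.
move=> a2 b2 aM bM sr ic ra cb non.
have dv e p : 2 <= e -> exists q, e * q <= p < e * q + e.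
  by move=> e2; exists (p %/ e); have := divn_eq p e; have := @ltn_pmod p e; lia.
(* Take as many [(xy)^a] and [(vz)^b] as [x] and [z] allow. If these are fewer than [T], the rest
   must be [yv], so [y] or [v] falls short; the two cases are mirror images. *)
have [k /andP[ks sk]] := dv a s a2; have [l /andP[li il]] := dv b i b2.
have [le|lt] := leqP T (k + l).
  have [le'|lt'] := leqP T k.
    case: (non T 0 0); first by lia.
    by split; nia.
  case: (non k 0 (T - k)); first by lia.
  by split; nia.
have [rm|rm] := ltnP r (a * k + (T - k - l)).
  by apply: (@core_degree_bound_aux a b s r c i k l) => //; rewrite li.
have [cm|cm] := ltnP c (b * l + (T - l - k)); last first.
  case: (non k (T - k - l) l); first by lia.
  by split; lia.
suff : i + c + r + s < 2 * M * T by lia.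
apply: (@core_degree_bound_aux b a i c r s l k) => //; [|by rewrite ks|by lia].
move=> k' j l' kT [h1 h2 h3 h4]; case: (non l' j k'); first by lia.
by split; lia.
Qed.

End CoreDegree.

Section TwoHeavyEdges.
Variables (K : fieldType) (n : nat).
Implicit Types (x y v z : 'I_n) (m f g h : 'X_{1..n}) (V : pred {set 'I_n}).
Implicit Types (F G : {set 'I_n}).

Lemma convex_fix V y b : convex V -> convex [pred F | V F && ((y \in F) == b)].
Proof.
move=> cV G k l /= /andP[VG yG] /andP[Vl yl]; rewrite (cV _ _ _ VG Vl) /=.
by move: yG yl; rewrite !inE; case: (y == k); case: (y == l); case: (y \in G); case: b.
Qed.

(** Faces avoiding [y] form a subcomplex, with the faces containing [y] as quotient. *)
Lemma acyclic_fix V y i : convex V ->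
  (forall b, acyclic K [pred F | V F && ((y \in F) == b)] i) -> acyclic K V i.
Proof.
move=> cV a; apply: (@acyclic_mid K n V (fun F => y \notin F)) => //.
- by move=> k G _ _; rewrite !inE negb_or => /andP[].
- by apply: eq_acyclic (a false) => F /=; case: (y \in F).
by apply: eq_acyclic (a true) => F /=; case: (y \in F).
Qed.

Lemma in_pow3P f h g T m :
  reflect (exists k j l, k + j + l = T /\ (f *+ k + h *+ j + g *+ l <= m)%MM)
          (in_pow [:: f; h; g] T m).
Proof.
apply: (iffP idP); elim: T m => [|T IH] m.
- by move=> _; exists 0, 0, 0; split => //; apply/mnm_lepP => j; rewrite !mnmDE !mnm0E.
- case/hasP => e; rewrite !inE => /or3P[]/eqP -> /andP[/mnm_lepP le /IH];
    move=> [k [j [l [kT /mnm_lepP le']]]].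
  + exists k.+1, j, l; split; first by lia.
    apply/mnm_lepP => u; have := le u; have := le' u.
    by rewrite !mnmDE !mulmnE mnmBE; nia.
  + exists k, j.+1, l; split; first by lia.
    apply/mnm_lepP => u; have := le u; have := le' u.
    by rewrite !mnmDE !mulmnE mnmBE; nia.
  exists k, j, l.+1; split; first by lia.
  apply/mnm_lepP => u; have := le u; have := le' u.
  by rewrite !mnmDE !mulmnE mnmBE; nia.
- by [].
have pick e k j l : k + j + l = T -> e \in [:: f; h; g] ->
    (f *+ k + h *+ j + g *+ l + e <= m)%MM -> in_pow [:: f; h; g] T.+1 m.
  move=> kT eE le; apply/hasP; exists e => //.
  rewrite (lepm_trans (lem_addl _ e) le); apply: IH; exists k, j, l; split=> //.
  apply/mnm_lepP => u; have := mnm_lepP le u; rewrite !mnmE; lia.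
case=> k [j [l []]].
case: k => [|k] kT; last first.
  rewrite mulmSr => le; apply: (@pick f k j l) => //; first by lia.
    by rewrite !inE eqxx.
  by apply: lepm_trans le; apply/mnm_lepP => u; rewrite !mnmDE; lia.
case: j kT => [|j] kT; last first.
  rewrite [(h *+ _)%MM]mulmSr => le; apply: (@pick h 0 j l) => //; first by lia.
    by rewrite !inE eqxx orbT.
  by apply: lepm_trans le; apply/mnm_lepP => u; rewrite !mnmDE; lia.
case: l kT => [|l] kT //.
rewrite [(g *+ _)%MM]mulmSr => le; apply: (@pick g 0 0 l) => //; first by lia.
  by rewrite !inE eqxx !orbT.
by apply: lepm_trans le; apply/mnm_lepP => u; rewrite !mnmDE; lia.
Qed.

Lemma in_pow_coreP x y v z a b T m : uniq [:: x; y; v; z] ->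
  reflect (exists k j l, k + j + l = T /\
     [/\ a * k <= m x, a * k + j <= m y, j + b * l <= m v & b * l <= m z])
    (in_pow (path_gens [:: x; y; v; z] [:: a; 1; b]) T m).
Proof.
rewrite /= !inE !negb_or !andbT => /and3P[/and3P[xy xv xz] /andP[yv yz] vz].
have N := (negbTE xy, negbTE xv, negbTE xz, negbTE yv, negbTE yz, negbTE vz,
  eq_sym y x, eq_sym v x, eq_sym z x, eq_sym v y, eq_sym z y, eq_sym z v).
have E u k j l : (edge x y a *+ k + edge y v 1 *+ j + edge v z b *+ l)%MM u =
   ((x == u) + (y == u)) * a * k + ((y == u) + (v == u)) * j +
   ((v == u) + (z == u)) * b * l.
  by rewrite !mnmDE !mulmnE !mnmDE !mnm1E muln1.
apply: (iffP (in_pow3P _ _ _ _ _)) => -[k [j [l [kT le]]]]; exists k, j, l; split=> //.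
  move/mnm_lepP: le => le; split; [move: (le x)|move: (le y)|move: (le v)|move: (le z)];
    rewrite E !eqxx !N; nia.
case: le => lx ly lv lz; apply/mnm_lepP => u; rewrite E.
have [<-|ux] := eqVneq x u; first by rewrite !N; nia.
have [<-|uy] := eqVneq y u; first by rewrite !N; nia.
have [<-|uv] := eqVneq v u; first by rewrite !N; nia.
by have [<-|uz] := eqVneq z u; first by nia.
Qed.

(** Strands with a large exponent are cones. In the others every basis monomial has degree below
    [2 * M * t.+1], which rules out faces of size [i]. *)
Lemma reg_bound_core x y v z a b M t d r : uniq [:: x; y; v; z] ->
  2 <= a -> 2 <= b -> a <= M -> b <= M -> d + 2 * M * t.+1 <= r.+1 ->
  reg_bound K (in_pow (path_gens [:: x; y; v; z] [:: a; 1; b]) t.+1) d r.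
Proof.
move=> us a2 b2 aM bM dr al i lt; set T := t.+1 in dr *; set I := in_pow _ _.
have IP m := @in_pow_coreP x y v z a b T m us.
have up : up_closed I by apply: up_closed_in_pow.
have E F u : (al - set_mnm F)%MM u = al u - (u \in F) by rewrite mnmBE set_mnmE.
have toggle u F : u \notin F -> 0 < al u ->
    (I (al - set_mnm F)%MM -> I (al - set_mnm (u |: F))%MM) ->
    std I al (u |: F) = std I al F.
  move=> uF au e; rewrite /std.
  have -> : (set_mnm (u |: F) <= al)%MM = (set_mnm F <= al)%MM.
    apply/idP/idP; first exact: std_leU.
    move/mnm_lepP => le; apply/mnm_lepP => j; have := le j.
    by rewrite !set_mnmE !inE; case: eqVneq => [->|].
  congr (_ && ~~ _); apply/idP/idP => //.
  by apply: up; apply: sub_std_leU.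
have [o /andP[on o0]|none] := pickP [pred o | (o \notin [:: x; y; v; z]) && (0 < al o)].
  apply: (@acyclic_indep K n _ o) => //; apply: in_pow_indep => g.
  exact: path_gens_notin.
have /and3P[] : [&& x \notin [:: y; v; z], y \notin [:: v; z] & v != z].
  by move: us; rewrite /= !inE andbT.
rewrite !inE !negb_or => /and3P[xy xv xz] /andP[yv yz] vz.
have N := (negbTE xy, negbTE xv, negbTE xz, negbTE yv, negbTE yz, negbTE vz,
  eq_sym y x, eq_sym v x, eq_sym z x, eq_sym v y, eq_sym z y, eq_sym z v).
have far e k j l p : k + j + l = T -> 2 <= e -> e * T < p -> e * k + j <= p - 1.
  by clear; nia.
have near p q p' q' : p + q <= p' -> p' < q' -> p <= q' - 1 by clear; lia.
(* A product of [T] generators uses at most [a * T] powers of [y], so any excess is irrelevant to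
   membership. *)
have [ya|ya] := ltnP (a * T) (al y).
  apply: (@acyclic_cone K n _ y) => F yF; apply: toggle => //; first exact: leq_ltn_trans ya.
  move/IP => [k [j [l [kT le]]]]; apply/IP; exists k, j, l; split=> //.
  move: le; rewrite !E !inE !eqxx !N (negbTE yF) /=; case=> ? _ ? ?; split=> //.
  exact: far kT a2 ya.
have [va|va] := ltnP (b * T) (al v).
  apply: (@acyclic_cone K n _ v) => F vF; apply: toggle => //; first exact: leq_ltn_trans va.
  move/IP => [k [j [l [kT le]]]]; apply/IP; exists k, j, l; split=> //.
  move: le; rewrite !E !inE !eqxx !N (negbTE vF) /=; case=> ? ? _ ?; split=> //.
  by rewrite addnC; apply: (far b l j k) => //; move: kT; clear; lia.
(* Fixing whether the face contains [y] fixes the exponent of [y]. No generator uses more of [x]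
   than of [y], so an exponent of [x] beyond that one makes a cone; likewise for [v] and [z]. *)
apply: (@acyclic_fix _ y); first exact: convex_std.
move=> b1; apply: (@acyclic_fix _ v); first by apply: convex_fix; apply: convex_std.
move=> b2'; have [yx|yx] := ltnP (al y - b1) (al x).
  apply: (@acyclic_cone K n _ x) => F xF /=.
  rewrite !inE !N /=.
  case: eqVneq => [yb|]; last by rewrite !andbF.
  rewrite !andbT; congr (_ && _); apply: toggle => //; first exact: leq_ltn_trans yx.
  move/IP => [k [j [l [kT le]]]]; apply/IP; exists k, j, l; split=> //.
  move: le; rewrite !E !inE !eqxx !N yb (negbTE xF) /=.
  by case=> ? h ? ?; split=> //; apply: near h yx.
have [vz'|vz'] := ltnP (al v - b2') (al z).
  apply: (@acyclic_cone K n _ z) => F zF /=.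
  rewrite !inE !N /=.
  case: (eqVneq (v \in F)) => [vb|]; last by rewrite !andbF.
  rewrite !andbT; congr (_ && _); apply: toggle => //; first exact: leq_ltn_trans vz'.
  move/IP => [k [j [l [kT le]]]]; apply/IP; exists k, j, l; split=> //.
  move: le; rewrite !E !inE !eqxx !N vb (negbTE zF) /=.
  by case=> ? ? h ?; split=> //; apply: near vz'; rewrite addnC; apply: h.
apply: acyclic_empty => F /= /andP[/andP[/andP[Fal FI] /eqP yF] /eqP vF].
apply/eqP => Fi.
have degE : mdeg (al - set_mnm F)%MM + i = mdeg al.
  by rewrite -{2}(submK Fal) mdegD mdeg_set_mnm Fi.
have sumE : mdeg (al - set_mnm F)%MM = (al x - (x \in F)) + (al y - (y \in F)) +
    (al v - (v \in F)) + (al z - (z \in F)).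
  rewrite mdegE (bigD1 x) //= (bigD1 y) /=; last by rewrite eq_sym.
  rewrite (bigD1 v) /=; last by rewrite ![v == _]eq_sym xv.
  rewrite (bigD1 z) /=; last by rewrite ![z == _]eq_sym xz yz.
  rewrite big1 => [|u /andP[/andP[/andP[ux uy] uv] uz]].
    by rewrite !E addn0 !addnA.
  have := none u; rewrite /= !inE (negbTE ux) (negbTE uy) (negbTE uv) (negbTE uz) /=.
  by rewrite E; case: (al u).
have : mdeg (al - set_mnm F)%MM < 2 * M * T.
  rewrite sumE; apply: (@core_degree_bound M T a b) => //; rewrite ?yF ?vF.
  - exact: leq_trans (leq_subr _ _) yx.
  - exact: leq_trans (leq_subr _ _) vz'.
  - exact: leq_trans (leq_subr _ _) ya.
  - exact: leq_trans (leq_subr _ _) va.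
  move=> k j l kT le; case/IP: FI; exists k, j, l; split=> //.
  by rewrite !E yF vF.
move: degE lt dr; clear; lia.
Qed.
End TwoHeavyEdges.

Section TwoHeavyEdgePaths.
Variables (K : fieldType) (n : nat).
Implicit Types (s : seq 'I_n) (x y v z : 'I_n) (a b d r t W : nat).
Local Notation linear_bound := (linear_bound K n).

(** With [M] the larger of [a] and [b], the first power has regularity at least [2 * M - 1], seen on
    the heavier edge, while the power [t.+1] has at most [2 * M * t.+1 - 1]. *)
Lemma linear_bound_core W a b : 2 <= a <= W -> 2 <= b <= W ->
  linear_bound W [:: a; 1; b].
Proof.
move=> /andP[a2 aW] /andP[b2 bW] s wf t d r reg1.
have [x [y [s1 e1]]] := path_wf_cons wf; subst s; have wf1 := path_wf_behead wf.
have [y' [v [s2 [_ e2]]]] := path_wf_cons wf1; subst s1.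
have wf2 := path_wf_behead wf1.
have [v' [z [s3 [_ e3]]]] := path_wf_cons wf2; subst s2.
have da := path_reg_first_ge wf reg1.
have db := path_reg_first_ge wf2 (path_reg_behead wf1 (path_reg_behead wf reg1)).
move: da db wf; have -> : s3 = [::] by case/and3P: wf2 => _ _; case: (s3).
move=> da db /and3P[us _ _]; apply: (@reg_bound_core K n x y v z a b (maxn a b)) => //.
- exact: leq_maxl.
- exact: leq_maxr.
have : maxn a b <= W by rewrite geq_max aW.
have : d + (2 * maxn a b).-1 <= r by case: (leqP a b); lia.
have : 0 < maxn a b by lia.
move: (maxn a b) => M; clear; nia.
Qed.

(** The leaf inequality at exponent one, where the colon is the unit ideal: an extra vertex costs at
    most one. *)
Lemma path_reg_unweighted_up s j d r : path_wf s (nseq j 1) ->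
  path_reg K (behead s) (nseq j.-1 1) 1 d.+1 r -> path_reg K s (nseq j 1) 1 d r.
Proof.
case: j => [|j] wf.
  rewrite /path_reg !path_gens_nil; apply: reg_bound_weaken; lia.
have [x [y [s' e]]] := path_wf_cons wf; subst s => b; have wf1 := path_wf_behead wf.
apply: path_reg_leaf => //; first exact: reg_bound_unit.
  by apply: path_reg_weaken b; lia.
exact: path_reg_behead wf1 b.
Qed.

(** The second heavy edge provides the shift. Restricting past the first edge and then past the edge
    of weight [b] gains [1 + (2 * b - 1) >= 4]: two pay for regaining two vertices, two for the
    shift in the leaf inequality. *)
Lemma path_reg_second x y s a b j d r : 2 <= b ->
  path_wf (x :: y :: s) [:: 1, a, 1, b & nseq j 1] ->
  path_reg K (x :: y :: s) [:: 1, a, 1, b & nseq j 1] 1 d r ->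
  path_reg K s [:: 1, b & nseq j 1] 1 d.+1 r.
Proof.
move=> b2 wf reg1; have wf2 := path_wf_behead (path_wf_behead wf).
have [z [v [s1 e]]] := path_wf_cons wf2; subst s; have wf3 := path_wf_behead wf2.
have [v' [q [s2 [_ e]]]] := path_wf_cons wf3; subst s1.
have wf4 := path_wf_behead wf3.
have b1 := path_reg_first wf reg1; have b2' := path_reg_first wf3 b1.
apply: path_reg_leaf => //; first exact: reg_bound_unit.
  by apply: path_reg_weaken b1; lia.
apply: path_reg_unweighted_up => //.
have E k : behead (nseq k 1) = nseq k.-1 1 by case: k.
have wf5 := path_wf_behead wf4; rewrite /= E in wf5.
apply: path_reg_unweighted_up => //.
by move: b2'; rewrite /= !E; apply: path_reg_weaken; lia.
Qed.

Lemma linear_bound_double_arm W a b i j : 2 <= a <= W -> 2 <= b <= W ->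
  linear_bound W [:: a, 1, b & nseq j 1] ->
  linear_bound W (nseq i 1 ++ [:: a, 1, b & nseq j 1]).
Proof.
move=> /andP[a2 aW] /andP[b2 bW] c1; have c2 : linear_bound W [:: 1, b & nseq j 1].
  by apply: (@linear_bound_single K n W b 1 j) => //; apply: leq_trans aW.
apply: linear_bound_arm => //; first by lia.
move=> x y s wf t d r reg1.
have wf2 := path_wf_behead (path_wf_behead wf).
exact: c2 _ wf2 t.+1 _ _ (path_reg_second b2 wf reg1).
Qed.

Lemma linear_bound_double W a b i j : 2 <= a <= W -> 2 <= b <= W ->
  linear_bound W (nseq i 1 ++ [:: a, 1, b & nseq j 1]).
Proof.
move=> aW bW; apply: linear_bound_double_arm => //.
(* The right arm is attached first, as a left arm of the reversed core. *)
have := linear_bound_rev (@linear_bound_double_arm W b a j 0 bW aW (linear_bound_core bW aW)).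
by rewrite rev_cat rev_nseq.
Qed.

End TwoHeavyEdgePaths.

(** * Integrally closed paths *)

Section MonomialIdeals.
Local Open Scope ring_scope.
Variables (K : fieldType) (n : nat).
Implicit Types (E : seq 'X_{1..n}) (m g : 'X_{1..n}) (G : seq {mpoly K[n]}).

Definition monomials E : seq {mpoly K[n]} := [seq 'X_[g] | g <- E].

Lemma in_ideal_mul G c p : p \in G -> in_ideal G (c * p).
Proof.
move=> pG; exists (mkseq (fun i => if i == index p G then c else 0) (size G)).
rewrite size_mkseq; split=> //; have lt : (index p G < size G)%N by rewrite index_mem.
rewrite (bigD1 (Ordinal lt)) //= nth_mkseq // eqxx nth_index // big1 ?addr0 //.
move=> i ne; rewrite nth_mkseq // ifN ?mul0r //.
Qed.

Lemma in_ideal0 G : in_ideal G 0.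
Proof.
exists (nseq (size G) 0); rewrite size_nseq; split=> //.
by rewrite big1 // => i _; rewrite nth_nseq; case: ifP; rewrite mul0r.
Qed.

Lemma in_ideal_monomialsP E m :
  in_ideal (monomials E) 'X_[m] <-> has (fun g => (g <= m)%MM) E.
Proof.
split=> [[c [_ e]]|/hasP[g gE le]]; last first.
  by rewrite -(submK le) mpolyXD; apply: in_ideal_mul; apply: map_f.
(* Compare coefficients at [m]: a multiple of the monomial of [g] only contains monomials divisible
   by it. *)
apply/negPn/negP => /hasPn no; have /eqP := congr1 (mcoeff m) e.
rewrite mcoeffX eqxx raddf_sum big1 ?oner_eq0 // => i _ /=.
have lt : (i < size E)%N by rewrite -(size_map (fun g => 'X_[g] : {mpoly K[n]})).
rewrite (nth_map 0%MM) //; apply/eqP; rewrite mcoeff_eq0.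
rewrite (perm_mem (msuppMX _ _)); apply/negP => /mapP[m' _ em].
by case/negP: (no _ (mem_nth 0%MM lt)); rewrite em lem_addr.
Qed.

Definition pow_gens E t : seq 'X_{1..n} :=
  iter t (fun H => [seq (g + h)%MM | g <- E, h <- H]) [:: 0%MM].

Lemma ideal_pow_gens_monomials E t :
  ideal_pow_gens (monomials E) t = monomials (pow_gens E t).
Proof.
rewrite /ideal_pow_gens /pow_gens; elim: t => [|t IH] /=.
  by rewrite /monomials /= mpolyX0.
rewrite IH /monomials allpairs_mapl allpairs_mapr map_allpairs.
by apply: eq_allpairs => g h; rewrite mpolyXD.
Qed.

Lemma has_pow_gens E t m : has (fun g => (g <= m)%MM) (pow_gens E t) = in_pow E t m.
Proof.
elim: t m => [|t IH] m.
  by rewrite /= orbF; apply/mnm_lepP => j; rewrite mnm0E.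
apply/hasP/hasP => [[_ /allpairsP[[g h] /= [gE hH ->]] le]|[g gE /andP[gm]]].
  exists g => //; apply/andP; split; first exact: lepm_trans (lem_addr _ _) le.
  suff : in_pow E t (m - g)%MM by [].
  rewrite -IH; apply/hasP; exists h => //.
  by apply/mnm_lepP => j; have := mnm_lepP le j; rewrite !mnmE; lia.
move=> h0; have {h0}: in_pow E t (m - g)%MM by exact: h0.
rewrite -IH => /hasP[h hH le]; exists (g + h)%MM; first exact: allpairs_f.
apply/mnm_lepP => j; have := mnm_lepP le j; have := mnm_lepP gm j.
by rewrite !mnmE; lia.
Qed.

Lemma std_mono_monomials E m : std_mono (monomials E) m = ~~ in_pow E 1 m.
Proof.
rewrite /std_mono in_pow1 /pbool.
case: excluded_middle_informative => h; first by rewrite (iffLR (in_ideal_monomialsP _ _) h).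
by apply/esym/negP => /in_ideal_monomialsP.
Qed.

Lemma std_mono_pow E t m :
  std_mono (ideal_pow_gens (monomials E) t) m = ~~ in_pow E t m.
Proof.
by rewrite ideal_pow_gens_monomials std_mono_monomials in_pow1 has_pow_gens.
Qed.

(** The monomial of [m] is a root of [X^2 - x^(2m)], an equation of integral dependence when
    [x^(2m)] lies in the square of the ideal. *)
Lemma integrally_closed_sqrt E m : integrally_closed (monomials E) ->
  in_pow E 2 (m + m)%MM -> in_pow E 1 m.
Proof.
move=> ic m2; rewrite in_pow1; apply/in_ideal_monomialsP/ic.
exists 2; split=> //; exists (fun i => if i == 2 then - 'X_[m + m] else 0); split.
  move=> i _; case: eqP => [->|_]; last exact: in_ideal0.
  rewrite ideal_pow_gens_monomials.
  move: m2; rewrite -has_pow_gens => /hasP[g gE le].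
  by rewrite -(submK le) mpolyXD -mulNr; apply: in_ideal_mul; apply: map_f.
by rewrite big_nat_recr //= big_nat1 /= mul0r add0r expr0 mulr1 expr2 mpolyXD subrr.
Qed.

End MonomialIdeals.

(** * Positions of the heavy edges *)

Section PathWeights.
Variables (n : nat) (w : nat -> nat).
Hypothesis w_gt0 : forall i, i < n.-1 -> 0 < w i.

Definition path_mnm (i : nat) : 'X_{1..n} :=
  [multinom if (k == i :> nat) || (k == i.+1 :> nat) then w i else 0 | k < n].

Lemma path_gens_mkseq :
  path_gens (enum 'I_n) (mkseq w n.-1) = [seq path_mnm i | i <- iota 0 n.-1].
Proof.
have gen (s : seq 'I_n) ws x0 : size ws = (size s).-1 ->
    path_gens s ws = mkseq (fun i => edge (nth x0 s i) (nth x0 s i.+1) (nth 0 ws i)) (size ws).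
  elim: s ws => [|x s IH] [|u ws] //= sz; first by rewrite path_gens_nil.
  case: s IH sz => [|y s] IH // [sz]; rewrite path_gens_cons (IH _ sz).
  have := iotaDl 1 0 (size ws); rewrite addn0 => it.
  by rewrite /mkseq /= it -map_comp.
have [n0|n0] := posnP n.
  have e : n.-1 = 0 by rewrite n0.
  by rewrite (size0nil (s := enum 'I_n)) ?size_enum_ord // e.
rewrite (gen _ _ (Ordinal n0)) ?size_mkseq ?size_enum_ord //.
apply/eq_in_map => i; rewrite mem_iota => /andP[_ lt].
apply/mnmP => k; rewrite edgeE mnmE nth_mkseq //.
have lt' : i.+1 < n by lia.
rewrite -!val_eqE /= !nth_enum_ord //; last exact: ltnW.
rewrite ![_ == nat_of_ord k]eq_sym.
case: (eqVneq (k : nat) i) => [->|_] /=; last by case: eqP; rewrite ?mul1n ?mul0n.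
by rewrite ltn_eqF // addn0 mul1n.
Qed.

Lemma closed_heavy_dist (K : fieldType) i j :
  integrally_closed (path_edge_gens K n w) ->
  i < j < n.-1 -> 2 <= w i -> 2 <= w j -> j = i.+2.
Proof.
move=> ic /andP[ij jn] wi wj; apply/eqP; apply: contraT => /eqP ne.
pose E := [seq path_mnm i | i <- iota 0 n.-1].
have {}ic : integrally_closed (monomials K E).
  by rewrite /monomials -map_comp.
pose c k := path_mnm i k + path_mnm j k.
(* The square root of the product of the two generators, with exponents rounded up. *)
pose m : 'X_{1..n} := [multinom uphalf (c k) | k < n].
have mE k : m k = uphalf (c k) by rewrite mnmE.
have cE k : c k = (if (k == i :> nat) || (k == i.+1 :> nat) then w i else 0) +
    (if (k == j :> nat) || (k == j.+1 :> nat) then w j else 0).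
  by rewrite /c !mnmE.
have mem l : l < n.-1 -> path_mnm l \in E by move=> ln; apply: map_f; rewrite mem_iota.
have m2 : in_pow E 2 (m + m)%MM.
  apply/hasP; exists (path_mnm i); first by apply: mem; lia.
  apply/andP; split.
    by apply/mnm_lepP => k; rewrite mnmDE mE /c; lia.
  suff : in_pow E 1 (m + m - path_mnm i)%MM by [].
  rewrite in_pow1; apply/hasP; exists (path_mnm j); first exact: mem.
  by apply/mnm_lepP => k; rewrite mnmBE mnmDE mE /c; lia.
have := integrally_closed_sqrt ic m2; rewrite in_pow1 => /hasP[g /mapP[l]].
rewrite mem_iota add0n => /andP[_ ln] -> /mnm_lepP le.
have l1 : l < n by lia. have l2 : l.+1 < n by lia.
have := le (Ordinal l1); have := le (Ordinal l2).
rewrite !mE !cE !mnmE /= eqxx orbT eqxx /=.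
(* Every edge has an end where [m] is too small: for [i] and [j] an outer end carries only half the
   weight, rounded up; any other edge has an end outside the support, as [j] is not [i.+2]. *)
have := w_gt0 ln.
have [e|n1] := eqVneq l i.
  by subst l; rewrite ?eqxx ?orbT /=; do ![case: ifP => ?]; lia.
have [e|n2] := eqVneq l j.
  by subst l; rewrite ?eqxx ?orbT /=; do ![case: ifP => ?]; lia.
by do ![case: ifP => ?]; lia.
Qed.

Lemma mkseq_single N p : p < N -> (forall i, i < N -> i != p -> w i = 1) ->
  mkseq w N = nseq p 1 ++ w p :: nseq (N - p.+1) 1.
Proof.
move=> pN w1; apply: (@eq_from_nth _ 1); rewrite size_mkseq.
  by rewrite size_cat /= !size_nseq; lia.
move=> i iN; rewrite nth_mkseq // nth_cat size_nseq nth_nseq.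
case: ltngtP => ip; first by rewrite w1 //; lia.
  case: (i - p) (subn_gt0 p i) => [|k]; first by rewrite ip.
  by rewrite /= nth_nseq if_same w1 //; lia.
by rewrite ip subnn.
Qed.

Lemma mkseq_double N p : p.+2 < N ->
  (forall i, i < N -> i != p -> i != p.+2 -> w i = 1) ->
  mkseq w N = nseq p 1 ++ [:: w p, 1, w p.+2 & nseq (N - p.+3) 1].
Proof.
move=> pN w1; apply: (@eq_from_nth _ 1); rewrite size_mkseq.
  by rewrite size_cat /= !size_nseq; lia.
move=> i iN; rewrite nth_mkseq // nth_cat size_nseq nth_nseq.
case: ltnP => ip; first by rewrite w1 //; lia.
case e: (i - p) => [|[|[|k]]] /=.
- by congr w; lia.
- by rewrite w1 //; lia.
- by congr w; lia.
by rewrite nth_nseq if_same w1 //; lia.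
Qed.

Lemma linear_bound_closed (K : fieldType) :
  (exists i, i < n.-1 /\ 2 <= w i) ->
  integrally_closed (path_edge_gens K n w) ->
  linear_bound K n (\max_(i < n.-1) w i) (mkseq w n.-1).
Proof.
move=> hv ic; have hv' : exists i, (i < n.-1) && (2 <= w i).
  by case: hv => i [h1 h2]; exists i; rewrite h1.
(* With [p] the first heavy edge, any other heavy edge must be [p.+2]. *)
case: (ex_minnP hv') => p /andP[pn wp] pmin.
set W := \max_(i < n.-1) w i.
have WE i : i < n.-1 -> w i <= W.
  by move=> h; apply: (@leq_bigmax_cond _ predT (fun i : 'I_n.-1 => w i) (Ordinal h)).
have light i : i < n.-1 -> ~~ (2 <= w i) -> w i = 1.
  by move=> h; have := w_gt0 h; lia.
have dist i : i < n.-1 -> 2 <= w i -> i != p -> i = p.+2.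
  move=> h h2 ne; apply: (closed_heavy_dist ic) => //; rewrite h andbT.
  by have := pmin i; rewrite h h2 => /(_ isT); lia.
have [/andP[qn wq]|nq] := boolP ((p.+2 < n.-1) && (2 <= w p.+2)).
  rewrite (mkseq_double qn) => [|i h1 h2 h3].
    by apply: linear_bound_double; rewrite ?wp ?wq WE.
  by apply: light => //; apply: contraNN h3 => h4; rewrite (dist i).
rewrite (mkseq_single pn) => [|i h1 h2].
  apply: linear_bound_single; last exact: WE.
  exact: leq_trans wp (WE _ pn).
apply: light => //; apply: contraNN nq => h4; rewrite -(dist i) //; exact/andP.
Qed.

End PathWeights.

(** * Regularity from the Koszul matrices *)

Section KoszulMatrices.
Local Open Scope ring_scope.
Variables (K : fieldType) (n : nat) (S : seq {mpoly K[n]}) (M : pred 'X_{1..n}).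
Hypothesis stdM : forall m, std_mono S m = ~~ M m.
Hypothesis upM : up_closed M.
Implicit Types (m al : 'X_{1..n}) (F G : {set 'I_n}) (i j r : nat).
Implicit Types (phi psi : 'X_{1..n} -> {set 'I_n} -> K).

Let basis_elt i j m F := [&& (mdeg m + #|F| == j)%N, #|F| == i & ~~ M m].

Let elt i j (c : 'I_(size (kbasis S i j))) := nth (bm0, set0) (kbasis S i j) c.

Let mem_kbasis i j (p : 'X_{1..n < j.+1} * {set 'I_n}) :
  (p \in kbasis S i j) = basis_elt i j (bmnm p.1) p.2.
Proof. by rewrite mem_filter mem_enum inE andbT stdM. Qed.

Let elt_basis i j c : basis_elt i j (bmnm (@elt i j c).1) (elt c).2.
Proof. by rewrite -mem_kbasis mem_nth. Qed.

Let basis_index i j m F : basis_elt i j m F ->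
  exists c : 'I_(size (kbasis S i j)), bmnm (elt c).1 = m /\ (elt c).2 = F.
Proof.
move=> b; have [/eqP mF _] := andP b.
have lt : (mdeg m < j.+1)%N by rewrite -mF ltnS leq_addr.
have pB : (BMultinom lt, F) \in kbasis S i j by rewrite mem_kbasis.
have ci : (index (BMultinom lt, F) (kbasis S i j) < size (kbasis S i j))%N.
  by rewrite index_mem.
by exists (Ordinal ci); rewrite /elt /= nth_index.
Qed.

Let kbasis_uniq i j : uniq (kbasis S i j).
Proof. by rewrite filter_uniq // enum_uniq. Qed.

Let elt_inj i j : injective (@elt i j).
Proof.
move=> c c' /eqP; rewrite nth_uniq ?kbasis_uniq //.
by move/eqP/val_inj.
Qed.

Let on_basis i j phi := forall m F, phi m F != 0 -> basis_elt i j m F.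

Let vec i j phi : 'rV[K]_(size (kbasis S i j)) :=
  \row_c phi (bmnm (elt c).1) (elt c).2.

(* The multidegree [al] component of a chain [phi]. *)
Let strand phi al F := if (set_mnm F <= al)%MM then phi (al - set_mnm F)%MM F else 0.

Let vec_surj i j (U : 'rV[K]_(size (kbasis S i j))) :
  exists2 phi, on_basis i j phi & vec i j phi = U.
Proof.
exists (fun m F => \sum_c if (bmnm (elt c).1 == m) && ((elt c).2 == F) then U 0 c else 0).
  move=> m F; apply: contraNT => nb; rewrite big1 // => c _.
  case: ifP => // /andP[/eqP em /eqP eF]; case/negP: nb.
  by rewrite -em -eF elt_basis.
apply/rowP => c; rewrite mxE (bigD1 c) //= !eqxx /= big1 ?addr0 // => c' ne.
case: ifP => // /andP[/eqP/val_inj e1 /eqP e2]; case/eqP: ne; apply: elt_inj.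
by rewrite [elt c']surjective_pairing [elt c]surjective_pairing e1 e2.
Qed.

(** Translates the matrix into the multigraded differential: the entry at [x^m e_G] only sees the
    strand of multidegree [m + G]. *)
Let mul_vec_kdiff i j phi (c : 'I_(size (kbasis S i j))) : on_basis i.+1 j phi ->
  (vec i.+1 j phi *m kdiff S i.+1 j) 0 c =
  koszul_bd (strand phi (bmnm (elt c).1 + set_mnm (elt c).2)%MM) (elt c).2.
Proof.
move=> ob; rewrite mxE.
set q := elt c; set m := bmnm q.1; set G := q.2.
pose X (p : 'X_{1..n < j.+1} * {set 'I_n}) k : K :=
  if [&& p \in kbasis S i.+1 j, k \in p.2, G == p.2 :\ k & m == (bmnm p.1 + U_(k))%MM]
  then phi (bmnm p.1) p.2 * (-1) ^+ #|[set l in p.2 | (l < k)%N]| else 0.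
transitivity (\sum_(p <- kbasis S i.+1 j) \sum_k X p k).
  rewrite (big_nth (bm0, set0)) big_mkord; apply: eq_bigr => r _.
  rewrite !mxE mulr_sumr big_mkcond; apply: eq_bigr => k _.
  rewrite /X mem_nth //= -/(elt r); case: (k \in _) => //=.
  by case: ifP => _; rewrite ?mulr0.
rewrite exchange_big /koszul_bd [RHS]big_mkcond; apply: eq_bigr => k _ /=.
have Xp p : X p k != 0 -> [/\ k \notin G, p.2 = k |: G, (U_(k) <= m)%MM &
    bmnm p.1 = (m - U_(k))%MM].
  rewrite /X; case: ifP; last by rewrite eqxx.
  case/and4P => _ kp /eqP GE /eqP mE _; rewrite GE mE; split.
  - by rewrite !inE eqxx.
  - by rewrite setD1K.
  - exact: lem_addl.
  by rewrite addmK.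
have lek : k \notin G -> (set_mnm (k |: G) <= m + set_mnm G)%MM = (U_(k) <= m)%MM.
  move=> kG; rewrite lep1mP; apply/mnm_lepP/idP => [/(_ k)|mk l].
    by rewrite mnmDE !set_mnmE !inE eqxx (negbTE kG) addn0 -lt0n.
  rewrite mnmDE !set_mnmE !inE; case: (eqVneq l k) => [->|_]; last exact: leq_addl.
  by rewrite -lt0n in mk; apply: leq_trans mk (leq_addr _ _).
have [kG|kG] := boolP (k \in G).
  by apply: big1 => p _; apply/eqP/negPn/negP => /Xp[]; rewrite kG.
rewrite /strand lek //; have [km|km] := boolP (U_(k) <= m)%MM; last first.
  rewrite mulr0; apply: big1 => p _; apply/eqP/negPn/negP => /Xp[].
  by rewrite (negbTE km).
have mE : (m + set_mnm G - set_mnm (k |: G) = m - U_(k))%MM.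
  apply/mnmP => l; rewrite !mnmE !inE eq_sym.
  by case: (eqVneq k l) => [<-|_]; rewrite ?(negbTE kG) ?addn0 ?subn0 ?addnK.
rewrite mE; have lt : (mdeg (m - U_(k)) < j.+1)%N.
  by apply: leq_ltn_trans (mdegB _ _) _; apply: bmdeg.
(* For a fixed [k], this is the only basis element that can contribute. *)
pose p0 : 'X_{1..n < j.+1} * {set 'I_n} := (BMultinom lt, k |: G).
have Xp0 p : X p k != 0 -> p = p0.
  case/Xp => _ e1 _ e2; rewrite [p]surjective_pairing /p0 e1; congr (_, _).
  exact: val_inj.
have X0 : X p0 k = if p0 \in kbasis S i.+1 j
    then koszul_sign K k G * phi (m - U_(k))%MM (k |: G) else 0.
  rewrite /X /= !inE eqxx setU1K // eqxx submK // eqxx !andbT.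
  case: ifP => // _; rewrite mulrC; congr (_ ^+ _ * _); apply: eq_card => l.
  by rewrite !inE; case: (eqVneq l k) => [->|//]; rewrite ltnn !andbF.
have [pB|pB] := boolP (p0 \in kbasis S i.+1 j); last first.
  rewrite (_ : phi _ _ = 0) ?mulr0; last first.
    apply/eqP; apply: contraNT pB => /ob; by rewrite mem_kbasis.
  apply: big1 => p _; apply/eqP/negPn/negP => Xnz.
  by move: (Xnz); rewrite (Xp0 _ Xnz) X0 (negbTE pB) eqxx.
rewrite (big_rem p0) //= X0 pB big_seq big1 ?addr0 // => p.
rewrite (mem_rem_uniq _ (kbasis_uniq _ _)) => /andP[/= ne _].
by apply/eqP; apply: contraNT ne => /Xp0 ->.
Qed.

Let strand_std i j phi al F : on_basis i j phi -> strand phi al F != 0 ->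
  std M al F && (#|F| == i).
Proof.
move=> ob; rewrite /strand /std; case: ifP => [_ /ob /and3P[_ -> ->] //|].
by rewrite eqxx.
Qed.

Let std_basis_elt i al G : std M al G -> #|G| = i ->
  basis_elt i (mdeg al) (al - set_mnm G)%MM G.
Proof.
case/andP=> le nM e; rewrite /basis_elt e eqxx nM andbT.
by rewrite -{2}(submK le) mdegD mdeg_set_mnm e eqxx.
Qed.

Let kdiff_kdiff i j : kdiff S i.+2 j *m kdiff S i.+1 j = 0.
Proof.
apply/row_matrixP => r; rewrite row_mul row0 rowE.
have [psi ob <-] := vec_surj (delta_mx 0 r).
pose phi m F := if basis_elt i.+1 j m F
  then koszul_bd (strand psi (m + set_mnm F)%MM) F else 0.
have obp : on_basis i.+1 j phi.
  by move=> m F; rewrite /phi; case: ifP; rewrite ?eqxx.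
have -> : vec i.+2 j psi *m kdiff S i.+2 j = vec i.+1 j phi.
  by apply/rowP => c; rewrite mul_vec_kdiff // mxE /phi elt_basis.
apply/rowP => c; rewrite mul_vec_kdiff // mxE.
set al := (_ + _)%MM; set G := (elt c).2.
have [/eqP dG /eqP sG nM] := and3P (elt_basis c).
have da : mdeg al = j by rewrite mdegD mdeg_set_mnm.
have Gs : std M al G by rewrite /std /al lem_addl addmK.
rewrite -[RHS](koszul_bd_trunc (u := strand psi al) (convex_std (al := al) upM) _ Gs).
  apply: eq_koszul_bd => k kG; rewrite {1}/strand /phi /std.
  case: (boolP (set_mnm _ <= al)%MM) => //= le.
  rewrite submK // /basis_elt -da -{2}(submK le) mdegD mdeg_set_mnm eqxx.
  by rewrite cardsU1 kG sG eqxx.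
by move=> F /(strand_std ob) /andP[].
Qed.

Let kernel i j : 'M[K]_(size (kbasis S i j)) :=
  if i is i'.+1 then kermx (kdiff S i'.+1 j) else 1%:M.

(** Rank-nullity turns the numerical test into a comparison of boundaries with cycles. *)
Let betti_nzE i j : betti_nz S i j = (\rank (kdiff S i.+1 j) < \rank (kernel i j))%N.
Proof.
by rewrite /betti_nz; case: i => [|i] /=; rewrite ?subn0 ?mxrank1 ?mxrank_ker.
Qed.

Let boundary_sub i j : (kdiff S i.+1 j <= kernel i j)%MS.
Proof.
case: i => [|i]; first exact: submx1.
by apply/sub_kermxP; apply: kdiff_kdiff.
Qed.

Let kernelP i j phi : on_basis i j phi -> (vec i j phi <= kernel i j)%MS <->
  forall al G, std M al G -> mdeg al = j -> koszul_bd (strand phi al) G = 0.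
Proof.
case: i => [|i] ob.
  split=> _; last exact: submx1.
  move=> al G _ _; apply: koszul_bd_eq0 => k kG; apply/eqP/negPn/negP.
  by move/(strand_std ob) => /andP[_]; rewrite cardsU1 kG.
split=> [/sub_kermxP U0 al G Gs da|b0]; last first.
  apply/sub_kermxP/rowP => c; rewrite mul_vec_kdiff // mxE; apply: b0.
    by have /and3P[_ _ nM] := elt_basis c; rewrite /std lem_addl addmK.
  by have /and3P[/eqP dG _ _] := elt_basis c; rewrite mdegD mdeg_set_mnm.
have [sG|sG] := eqVneq #|G| i; last first.
  apply: koszul_bd_eq0 => k kG; apply/eqP/negPn/negP => /(strand_std ob) /andP[_].
  by rewrite cardsU1 kG add1n eqSS (negbTE sG).
have := std_basis_elt Gs sG; rewrite da => /basis_index[c [e1 e2]].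
have := mul_vec_kdiff c ob; rewrite U0 mxE e1 e2 submK; last by case/andP: Gs.
by move=> <-.
Qed.

(** The homology in degree [j] is the direct sum of that of the strands of total degree [j]. *)
Lemma reg_leP r : reg_le S r <-> reg_bound K M 0 r.
Proof.
have subK i j : ~~ betti_nz S i j <-> (kernel i j <= kdiff S i.+1 j)%MS.
  rewrite betti_nzE -leqNgt -(mxrank_leqif_sup (boundary_sub i j)).
  by rewrite eqn_leq (mxrank_leqif_sup (boundary_sub i j)).
split=> [reg al i lt u su cu|reg i j].
  set j := mdeg al; rewrite addn0 -/j in lt.
  have /subK ker : ~~ betti_nz S i j by apply: contraTN lt => /reg; rewrite -leqNgt.
  (* A cycle of one strand, extended by zero to the other multidegrees. *)
  pose phi m F := if (m + set_mnm F == al)%MM then u F else 0.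
  have ob : on_basis i j phi.
    move=> m F; rewrite /phi; case: ifP => [/eqP e|_]; last by rewrite eqxx.
    move/su/andP => [/andP[_ nM] sF]; rewrite /basis_elt sF /j -e mdegD mdeg_set_mnm.
    by rewrite eqxx; rewrite -e addmK in nM.
  have strandE be F : strand phi be F = if be == al then u F else 0.
    rewrite /strand /phi; case: (boolP (set_mnm F <= be)%MM) => le.
      by rewrite submK.
    case: eqP le => // -> le; apply/esym/eqP; apply: contraNT le => /su.
    by case/andP=> /andP[].
  have /(submx_trans)/(_ ker)/submxP[X XE] : (vec i j phi <= kernel i j)%MS.
    apply/(kernelP ob) => be G Gs _.
    have [e|ne] := eqVneq be al.
      rewrite -(cu G) -?e //; apply: eq_koszul_bd => k _.
      by rewrite strandE e eqxx.
    by apply: koszul_bd_eq0 => k _; rewrite strandE (negbTE ne).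
  have [psi obp pE] := vec_surj X.
  exists (strand psi al) => [F|G Gs]; first exact: (strand_std obp).
  have [sG|sG] := eqVneq #|G| i; last first.
    have -> : u G = 0 by apply/eqP; apply: contraNT sG => /su /andP[].
    apply: koszul_bd_eq0 => k kG; apply/eqP/negPn/negP => /(strand_std obp) /andP[_].
    by rewrite cardsU1 kG add1n eqSS (negbTE sG).
  have [c [e1 e2]] := basis_index (std_basis_elt Gs sG).
  have := mul_vec_kdiff c obp; rewrite pE -XE mxE e1 e2 /phi submK ?eqxx //.
  by case/andP: Gs.
rewrite leqNgt; apply: contraL => lt; apply/subK/row_subP => r0.
have [phi ob phiE] := vec_surj (row r0 (kernel i j)).
have cyc : (vec i j phi <= kernel i j)%MS by rewrite phiE row_sub.
move/(kernelP ob): cyc => cyc.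
(* Choose a bounding chain in each multidegree; [psi] glues them together. *)
have ex al : {v | mdeg al = j -> supported (std M al) i.+1 v /\
    forall G, std M al G -> koszul_bd v G = strand phi al G}.
  apply: constructive_indefinite_description.
  have [da|] := eqVneq (mdeg al) j; last by move=> /eqP ne; exists (fun=> 0).
  have lt' : (i + r < mdeg al + 0)%N by rewrite addn0 da.
  have [F|G Gs|v sv bv] := reg al i lt' (strand phi al).
  - exact: (strand_std ob).
  - exact: cyc.
  by exists v.
pose psi m F := let al := (m + set_mnm F)%MM in
  if mdeg al == j then sval (ex al) F else 0.
have obp : on_basis i.+1 j psi.
  move=> m F; rewrite /psi; case: ifP => [/eqP da|_]; last by rewrite eqxx.
  have [sv _] := svalP (ex (m + set_mnm F)%MM) da.
  move/sv => /andP[/andP[_ nM] sF]; rewrite /basis_elt sF -da mdegD mdeg_set_mnm eqxx.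
  by rewrite addmK in nM.
rewrite -phiE; apply/submxP; exists (vec i.+1 j psi).
apply/rowP => c; rewrite mul_vec_kdiff // mxE.
set al := (_ + _)%MM; set G := (elt c).2.
have [/eqP dG /eqP sG nM] := and3P (elt_basis c).
have da : mdeg al = j by rewrite mdegD mdeg_set_mnm.
have Gs : std M al G by rewrite /std /al lem_addl addmK.
have [sv bv] := svalP (ex al) da.
have -> : koszul_bd (strand psi al) G = koszul_bd (sval (ex al)) G.
  apply: eq_koszul_bd => k _; rewrite /strand; case: (boolP (_ <= al)%MM) => le.
    by rewrite /psi /= submK // ifT //; apply/eqP.
  by apply/esym/eqP; apply: contraNT le => /sv /andP[/andP[]].
by rewrite bv // /strand lem_addl addmK.
Qed.

End KoszulMatrices.

Theorem theorem4p15 (K : fieldType) (n : nat) (w : nat -> nat) :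
  (5 <= n)%N ->
  (forall i, (i < n.-1)%N -> (0 < w i)%N) ->
  (exists i, (i < n.-1)%N /\ (2 <= w i)%N) ->
  integrally_closed (path_edge_gens K n w) ->
  forall t r : nat, (1 <= t)%N ->
    is_reg (path_edge_gens K n w) r ->
    reg_le (ideal_pow_gens (path_edge_gens K n w) t)
           (r + 2 * (t - 1) * \max_(i < n.-1) w i)%N.
Proof.
move=> _ w0 heavy closed [|t] r // _ [reg1 _].
have bound := linear_bound_closed w0 heavy closed.
pose E := path_gens (enum 'I_n) (mkseq w n.-1).
have gensE : path_edge_gens K n w = monomials K E.
  by rewrite /E path_gens_mkseq // /monomials -map_comp.
have wf : path_wf (enum 'I_n) (mkseq w n.-1).
  rewrite /path_wf enum_uniq size_mkseq size_enum_ord eqxx andbT.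
  by apply/allP => u /mapP[i]; rewrite mem_iota => /andP[_ lt] ->; apply: w0.
rewrite gensE in reg1 *; rewrite subn1.
apply/(reg_leP (std_mono_pow K E t.+1) (@up_closed_in_pow _ E _)).
apply: (bound _ wf t 0 r).
by apply/(reg_leP (std_mono_monomials K E) (@up_closed_in_pow _ E _)).
Qed.
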